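(* Let $s\in(0,1)$, let $a$ be a spectral measure on $\mathbb S^{n-1}$, let $\Omega\subset\mathbb R^n$ be open and $u\in C^2(\Omega)\cap L^\infty(\mathbb R^n)$. Then for every $x\in\Omega$, $$u(x)=\mathscr M^s_r u(x)+c(n,s,a)\,r^{2s}\,\mathcal L u(x)+\mathcal O(r^2)\qquad\text{as } r\to0.$$
   Context: A spectral measure is a non-negative finite Borel measure $a$ on $\mathbb S^{n-1}$ with $0<\int_{\mathbb S^{n-1}}da\le\Lambda$ for some $\Lambda>0$. With $\delta(u,x,y)=2u(x)-u(x-y)-u(x+y)$: $$\mathcal L u(x)=\int_0^\infty d\rho\int_{\mathbb S^{n-1}}da(\omega)\,\frac{\delta(u,x,\rho\omega)}{\rho^{1+2s}},\qquad \mathscr M^s_r u(x)=c(n,s,a)\,r^{2s}\int_r^\infty d\rho\int_{\mathbb S^{n-1}}da(\omega)\,\frac{u(x+\rho\omega)+u(x-\rho\omega)}{(\rho^2-r^2)^s\rho},$$ with $c(n,s,a)=\frac{\sin\pi s}{\pi}\big(\int_{\mathbb S^{n-1}}da\big)^{-1}$. *)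

(* Defs.v *)
From HB Require Import structures.
From mathcomp Require Import all_boot all_order all_algebra.
From mathcomp Require Import all_classical all_reals all_analysis.
Set Implicit Arguments. Unset Strict Implicit. Unset Printing Implicit Defensive.
Import Order.TTheory GRing.Theory Num.Theory.
Import numFieldNormedType.Exports.
Local Open Scope classical_set_scope.
Local Open Scope ring_scope.

Definition Rn (R : realType) (n : nat) : Type :=
  g_sigma_algebraType (@open 'rV[R]_n).

Definition sphere (R : realType) (n : nat) : set 'rV[R]_n :=
  [set w | \sum_(i < n) (w ord0 i) ^+ 2 = 1].

Definition ebase {R : realType} {n : nat} (i : 'I_n) : 'rV[R]_n :=
  delta_mx ord0 i.

Definition C2_on (R : realType) (n : nat) (O : set 'rV[R]_n)
  (u : 'rV[R]_n -> R) : Prop :=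
  forall x, O x ->
    {for x, continuous u} /\
    forall i j : 'I_n,
      [/\ derivable u x (ebase i),
          derivable ('D_(ebase i) u) x (ebase j),
          {for x, continuous ('D_(ebase i) u)} &
          {for x, continuous ('D_(ebase j) ('D_(ebase i) u))}].

Definition delta2 (R : realType) (n : nat) (u : 'rV[R]_n -> R)
  (x y : 'rV[R]_n) : R := 2 * u x - u (x - y) - u (x + y).

Definition cnsa (R : realType) (n : nat) (s : R)
  (a : {measure set (Rn R n) -> \bar R}) : R :=
  sin (pi * s) / pi / fine (a (@sphere R n)).

Definition Lop (R : realType) (n : nat) (s : R)
  (a : {measure set (Rn R n) -> \bar R}) (u : 'rV[R]_n -> R)
  (x : 'rV[R]_n) : R :=
  Rintegral (@lebesgue_measure R) `]0, +oo[%classic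
    (fun rho : R =>
       Rintegral a (@sphere R n : set (Rn R n))
         (fun w : Rn R n => delta2 u x (rho *: (w : 'rV[R]_n)))
       / rho `^ (1 + 2 * s)).

Definition Mop (R : realType) (n : nat) (s : R)
  (a : {measure set (Rn R n) -> \bar R}) (r : R) (u : 'rV[R]_n -> R)
  (x : 'rV[R]_n) : R :=
  cnsa s a * r `^ (2 * s) *
  Rintegral (@lebesgue_measure R) `]r, +oo[%classic
    (fun rho : R =>
       Rintegral a (@sphere R n : set (Rn R n))
         (fun w : Rn R n =>
            u (x + rho *: (w : 'rV[R]_n)) + u (x - rho *: (w : 'rV[R]_n)))
       / ((rho ^+ 2 - r ^+ 2) `^ s * rho)).

(* Main.v *)
(** With A the total mass of a and g(rho) the integral of delta(u, x, rho w)
    over the sphere, the identity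
      int_r^oo drho / ((rho^2 - r^2)^s rho) = r^(-2s) pi / (2 sin(pi s))
    turns u(x) - M_r u(x) into c r^(2s) times the integral of g against the
    mean kernel, so that the claim compares that kernel with rho^(-1-2s).
    Since |g(rho)| <= Q rho^2 (for small rho because u is C^2, for large rho
    because u is bounded), the difference of the two integrals is at most Q
    times int_0^r rho^(1-2s) + int_r^oo rho^2 (mean kernel - rho^(-1-2s)), and
    both of these have elementary primitives and value r^(2-2s) / (2(1-s)).

    The kernel identity is, after rho = r sqrt(1 + e^t), the reflection formula
    F(s) := int_R e^(st) / (1 + e^t) dt = pi / sin(pi s), proved by Herglotz'
    trick: both sides satisfy f(s/3) + f((s+2)/3) = 3 f(s) + f((s+1)/3) and
    f(1-s) = f(s), and both are 1/s + O(s) at 0. *)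

Require Import Defs.
From HB Require Import structures.
From mathcomp Require Import all_boot all_order all_algebra.
From mathcomp Require Import all_classical all_reals all_analysis.
From mathcomp Require Import measurable_realfun ring lra.
Set Implicit Arguments. Unset Strict Implicit. Unset Printing Implicit Defensive.
Import Order.TTheory GRing.Theory Num.Theory.
Import numFieldNormedType.Exports.
Local Open Scope classical_set_scope.
Local Open Scope ring_scope.

(** * The reflection formula *)

(** At t = pi/3 the equation cos 3t = -1 factors as (cos t + 1) (2 cos t - 1)^2 = 0, and cos t >
    0. *)
Lemma cos_pi_third (R : realType) : cos (pi / 3) = 1 / 2 :> R.
Proof.
have pi0 := pi_gt0 R.
set t := pi / 3 : R.
have c0 : 0 < cos t by apply: cos_gt0_pihalf; rewrite /t; apply/andP; split; lra.
have : cos (t + t + t) = - 1 by rewrite -cospi; congr cos; rewrite /t; lra.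
rewrite !cosD !sinD => h.
have s2 : sin t ^+ 2 = 1 - cos t ^+ 2 by rewrite sin2cos2.
have h3 : (cos t + 1) * (2 * cos t - 1) ^+ 2 = 0.
  have h' : 1 = - ((cos t * cos t - sin t * sin t) * cos t -
    (sin t * cos t + cos t * sin t) * sin t) by rewrite h; ring.
  transitivity (cos t ^+ 3 - 3 * (sin t ^+ 2) * cos t + 1); first
      by rewrite s2; ring.
  by rewrite {2}h'; ring.
move/eqP: h3; rewrite mulf_eq0 sqrf_eq0 => /orP[|] /eqP ?; lra.
Qed.

(** With t = x/3, S = sin t, A = sin (pi/3 + t) and B = sin (pi/3 - t), one has sin x = 4SAB, S = A
    - B and AB + S^2 = 3/4. Hence 3 / sin x = (3/4) / (SAB) = 1/S + S/(AB), and S/(AB) = 1/B -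
    1/A. *)
Lemma csc_triple (R : realType) (x : R) : 0 < x < pi ->
  (sin (x / 3))^-1 + (sin ((x + 2 * pi) / 3))^-1 =
  3 * (sin x)^-1 + (sin ((x + pi) / 3))^-1.
Proof.
move=> /andP[x0 xpi]; have pi0 := pi_gt0 R.
have S0 : sin (x / 3) != 0.
  by apply/lt0r_neq0/sin_gt0_pi/andP; split; lra.
have B0 : sin ((x + 2 * pi) / 3) != 0.
  by apply/lt0r_neq0/sin_gt0_pi/andP; split; lra.
have A0 : sin ((x + pi) / 3) != 0.
  by apply/lt0r_neq0/sin_gt0_pi/andP; split; lra.
have X0 : sin x != 0 by apply/lt0r_neq0/sin_gt0_pi/andP; split; lra.
set t := x / 3 in S0 *.
have q : sin (pi / 3) ^+ 2 = 3 / 4 :> R.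
  by rewrite sin2cos2 cos_pi_third; field.
have eA : sin ((x + pi) / 3) = sin t * (1/2) + cos t * sin (pi / 3).
  by rewrite -cos_pi_third -sinD; congr sin; rewrite /t; ring.
have eB : sin ((x + 2 * pi) / 3) = cos t * sin (pi / 3) - sin t * (1/2).
  transitivity (sin (pi / 3 - t)); last by rewrite sinB cos_pi_third; ring.
  by rewrite -[RHS]opprK -sinN -sinDpi; congr sin; rewrite /t; field.
have c2 : cos t ^+ 2 = 1 - sin t ^+ 2 by rewrite cos2sin2.
have eAB : sin ((x + pi) / 3) * sin ((x + 2 * pi) / 3) = 3 / 4 - sin t ^+ 2.
  rewrite eA eB.
  transitivity (cos t ^+ 2 * sin (pi / 3) ^+ 2 - sin t ^+ 2 / 4); first by field.
  by rewrite q c2; field.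
have eX : sin x =
    4 * (sin t * (sin ((x + pi) / 3) * sin ((x + 2 * pi) / 3))).
  rewrite eAB (_ : x = t + t + t); last by rewrite /t; field.
  rewrite !sinD cosD.
  transitivity (3 * (cos t ^+ 2) * sin t - sin t ^+ 3); first by ring.
  by rewrite c2; field.
have eS : sin t = sin ((x + pi) / 3) - sin ((x + 2 * pi) / 3).
  by rewrite eA eB; field.
move: eX eS eAB A0 B0; move: (sin ((x + pi) / 3)) (sin ((x + 2 * pi) / 3)).
move=> A B eX eS eAB A0 B0.
have : A * B + sin t ^+ 2 = 3 / 4 by rewrite eAB; ring.
rewrite eX => e.
have -> : 3 * (4 * (sin t * (A * B)))^-1 = (3 / 4) / (sin t * (A * B)).
  by field; rewrite A0 B0 S0.
rewrite -e.
rewrite -[RHS](_ : (sin t)^-1 + sin t / (A * B) + A^-1 = _); last first.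
  by field; rewrite A0 B0 S0.
rewrite {3}eS; by field; rewrite A0 B0.
Qed.

(** The mean value theorem gives |sin y| <= y, the half-angle formula then gives cos y >= 1 - y^2/2,
    and this is the sign of the derivative of sin y - y + y^3/6. *)
Lemma sin_ge_cubic (R : realType) (x : R) : 0 <= x -> x - x ^+ 3 / 6 <= sin x.
Proof.
move=> x0.
have ler_sin (y : R) : 0 <= y -> `|sin y| <= y.
  rewrite le_eqVlt => /predU1P[<-|y0]; first by rewrite sin0 normr0.
  have [c _ E] := @MVT R sin cos _ _ y0
    (fun z _ => is_derive_sin z) (continuous_subspaceT (@continuous_sin R)).
  move: E; rewrite sin0 !subr0 => ->.
  by rewrite normrM (gtr0_norm y0) ler_piMl ?cos_max // ltW.
have cosge (y : R) : 0 <= y -> 1 - y ^+ 2 / 2 <= cos y.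
  move=> y0; have -> : cos y = 1 - 2 * sin (y / 2) ^+ 2.
    rewrite {1}(_ : y = (y / 2) *+ 2); last by rewrite mulr2n; field.
    rewrite cos_mulr2n mulr2n cos2sin2; ring.
  have h := ler_sin (y / 2) (divr_ge0 y0 (ler0n _ 2)).
  move: h.
  rewrite -ler_sqr ?nnegrE ?divr_ge0// !real_normK ?num_real// => h2.
  have -> : y ^+ 2 / 2 = 2 * (y / 2) ^+ 2 by field.
  lra.
move: x0; rewrite le_eqVlt => /predU1P[<-|x0]; first
    by rewrite sin0 expr0n/= mul0r subr0.
pose f (y : R) := sin y - y + y ^+ 3 / 6.
have df (y : R) : is_derive y 1 f (cos y - 1 + y ^+ 2 / 2).
  rewrite /f.
  apply: is_derive_eq.
  by rewrite /GRing.scale /=; field.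
have [c c0x E] := @MVT R f _ _ _ x0 (fun z _ => df z)
   (@derivable_within_continuous R R f `[0,x]
     (fun z _ => @ex_derive _ _ _ _ _ _ _ (df z))).
move: E; rewrite {2}/f sin0 expr0n/= mul0r !subr0 addr0 subr0 => E.
suff : 0 <= f x by rewrite /f; lra.
rewrite E mulr_ge0 ?(ltW x0)//.
have := cosge c; move: c0x; rewrite in_itv/= => /andP[c0 _].
by move=> /(_ (ltW c0)); lra.
Qed.

Lemma ge0_integralD_EFin (R : realType) (D : set R) (f g : R -> R) :
  measurable D -> (forall x, 0 <= f x) -> (forall x, 0 <= g x) ->
  measurable_fun D f -> measurable_fun D g ->
  (\int[lebesgue_measure]_(x in D) (f x + g x)%:E =
   \int[lebesgue_measure]_(x in D) (f x)%:E +
   \int[lebesgue_measure]_(x in D) (g x)%:E)%E.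
Proof.
move=> mD f0 g0 mf mg; under eq_integral do rewrite EFinD.
rewrite ge0_integralD//.
- by move=> x _; rewrite lee_fin f0.
- exact/measurable_EFinP.
- by move=> x _; rewrite lee_fin g0.
- exact/measurable_EFinP.
Qed.

(** * The beta integral and its functional equations *)

Definition beta_kernel (R : realType) (s t : R) : R :=
  expR (s * t) / (1 + expR t).

Lemma beta_kernel_ge0 (R : realType) (s t : R) : 0 <= beta_kernel s t.
Proof. by rewrite /beta_kernel divr_ge0 ?addr_ge0 ?expR_ge0. Qed.

Lemma continuous_expRM (R : realType) (s : R) :
  continuous (fun t : R => expR (s * t)).
Proof.
move=> t; apply: (@continuous_comp _ _ _ (fun t : R => s * t) expR).
  exact: mulrl_continuous.
exact: continuous_expR.
Qed.

Lemma continuous_beta_kernel (R : realType) (s : R) :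
  continuous (beta_kernel s).
Proof.
move=> t; apply: cvgM; first exact: continuous_expRM.
apply: cvgV; first by rewrite lt0r_neq0// ltr_pwDl ?expR_ge0.
by apply: cvgD; [exact: cvg_cst|exact: continuous_expR].
Qed.

(** Euler's B(s, 1 - s) in the variable t = ln x, which makes x |-> x^3 linear. *)
Definition beta_int (R : realType) (s : R) : \bar R :=
  \int[lebesgue_measure]_t (beta_kernel s t)%:E.

Lemma measurable_beta_kernel (R : realType) (s : R) (D : set R) :
  measurable_fun D (beta_kernel s).
Proof.
apply: measurable_funTS; apply: continuous_measurable_fun.
exact: continuous_beta_kernel.
Qed.

Lemma measurable_beta_kernelM (R : realType) (s c : R) (D : set R) :
  measurable_fun D (fun t => beta_kernel s (c * t)).
Proof.
apply: measurable_funTS; apply: continuous_measurable_fun => t.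
apply: (@continuous_comp _ _ _ (fun t : R => c * t) (beta_kernel s)).
  exact: mulrl_continuous.
exact: continuous_beta_kernel.
Qed.

Lemma beta_kernelN (R : realType) (s t : R) :
  beta_kernel s (- t) = beta_kernel (1 - s) t.
Proof.
rewrite /beta_kernel mulrN mulrBl mul1r !expRN expRD expRN.
have := expR_gt0 t; have := expR_gt0 (s * t).
move: (expR t) (expR (s * t)) => a b b0 a0.
by field; rewrite !lt0r_neq0//; lra.
Qed.

(** The substitution t -> -t on the negative half-line exchanges s and 1 - s. The folded form shows
    the symmetry, and it is the one estimated near s = 0. *)
Lemma beta_int_fold (R : realType) (s : R) :
  beta_int s = (\int[lebesgue_measure]_(t in `[0%R, +oo[)
    (beta_kernel s t + beta_kernel (1 - s) t)%:E)%E.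
Proof.
have p0 := beta_kernel_ge0; have m0 := measurable_beta_kernel.
have mpos : measurable [set x : R | 0 <= x] by rewrite -set_itvcy.
rewrite /beta_int -(setUv [set x : R | 0 <= x]) ge0_integral_setU//=; last 4 first.
- exact: measurableC.
- apply/measurable_EFinP; apply: m0.
- by move=> x _; rewrite lee_fin p0.
- exact/disj_setPCl.
rewrite (ge0_integralD_EFin (measurable_itv `[0, +oo[) (p0 R s) (p0 R (1 - s))
  (m0 R s _) (m0 R (1 - s) _)).
suff -> : (\int[lebesgue_measure]_(t in ~` [set x | (0 <= x)%R])
    (beta_kernel s t)%:E =
    \int[lebesgue_measure]_(t in `[0%R, +oo[) (beta_kernel (1 - s) t)%:E)%E.
  by rewrite set_itvcy.
rewrite -set_itvcy setCitvr integral_itv_bndo_bndc; last first.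
  by apply/measurable_EFinP; apply: m0.
have := @ge0_integration_by_substitutionNy R (beta_kernel s) 0.
rewrite oppr0 => ->.
- by apply: eq_integral => /= x _; rewrite beta_kernelN.
- exact/continuous_subspaceT/continuous_beta_kernel.
- by move=> x _; exact: p0.
Qed.

Lemma beta_int_sym (R : realType) (s : R) : beta_int (1 - s) = beta_int s.
Proof.
rewrite !beta_int_fold; apply: eq_integral => t _.
by rewrite (_ : 1 - (1 - s) = s) 1?addrC//; ring.
Qed.

Lemma beta_int_scale3 (R : realType) (s : R) :
  beta_int s = (3%:E * \int[lebesgue_measure]_t (beta_kernel s (3 * t))%:E)%E.
Proof.
have D3 : derive1 (fun t : R => 3 * t) = cst 3.
  apply/funext => t; rewrite derive1E.
  by rewrite deriveM// derive_cst derive_id scaler0 addr0 /GRing.scale/= mulr1.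
rewrite /beta_int
  (@increasing_ge0_integration_by_substitutionT _ (fun t : R => 3 * t)) ?D3.
- rewrite -ge0_integralZl//=.
  + by apply: eq_integral => t _; rewrite !fctE mulrC EFinM.
  + apply/measurable_EFinP; apply: measurable_beta_kernelM.
  + by move=> t _; rewrite lee_fin beta_kernel_ge0.
- by move=> x y xy; rewrite ltr_pM2l.
- exact: cst_continuous.
- exact: is_cvg_cst.
- exact: is_cvg_cst.
- by move=> x; apply: derivableM.
- by apply: gt0_cvgMrNy.
- by apply: gt0_cvgMry.
- exact: continuous_beta_kernel.
- exact: beta_kernel_ge0.
Qed.

(** Rescaling t by 3 in every term but [beta_int s] turns the denominators into 1 + a^3 with a =
    e^t. With b = e^(st) the integrands then agree pointwise: (b + b a^2) / (1 + a^3) = b / (1 + a)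
    + b a / (1 + a^3), because 1 + a^3 = (1 + a) (1 - a + a^2). *)
Lemma beta_int_triple (R : realType) (s : R) :
  (beta_int (s / 3) + beta_int ((s + 2) / 3) =
  3%:E * beta_int s + beta_int ((s + 1) / 3))%E.
Proof.
rewrite !(@beta_int_scale3 _ (_ / 3)).
have mk' (c : R) D : measurable_fun D (fun t : R => beta_kernel c (3 * t)).
  exact: measurable_beta_kernelM.
pose I (c : R) := (\int[lebesgue_measure]_t (beta_kernel c (3 * t))%:E)%E.
have I0 c : (0 <= I c)%E by apply: integral_ge0 => t _;
    rewrite lee_fin beta_kernel_ge0.
have J0 : (0 <= beta_int s)%E by apply: integral_ge0 => t _;
    rewrite lee_fin beta_kernel_ge0.
transitivity (3%:E * (I (s / 3)%R + I ((s + 2) / 3)%R))%E; first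
    by rewrite (ge0_muleDr _ (I0 _) (I0 _)).
transitivity (3%:E * (beta_int s + I ((s + 1) / 3)%R))%E; last
    by rewrite (ge0_muleDr _ J0 (I0 _)).
congr (_ * _)%E.
rewrite -(ge0_integralD_EFin measurableT
  (fun t => beta_kernel_ge0 (s / 3) (3 * t))
  (fun t => beta_kernel_ge0 ((s + 2) / 3) (3 * t)) (mk' _ _) (mk' _ _)).
rewrite -(ge0_integralD_EFin measurableT (beta_kernel_ge0 s)
  (fun t => beta_kernel_ge0 ((s + 1) / 3) (3 * t))
  (@measurable_beta_kernel R s _) (mk' _ _)).
apply: eq_integral => t _; congr (_%:E).
rewrite /beta_kernel.
have ec (c : R) : c / 3 * (3 * t) = c * t by field.
rewrite !ec !mulrDl mul1r. rewrite !expRD.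
have := expR_gt0 t; move: (expR t) (expR (s * t)) => a b a0.
have : 1 + a * (a * a) != 0.
  by apply: lt0r_neq0; have := mulr_gt0 a0 (mulr_gt0 a0 a0); lra.
have : 1 + a != 0 by apply: lt0r_neq0; lra.
by move=> h1 h2; field; rewrite h1 h2.
Qed.

(** If m is the supremum of D, the inequality propagates the gap between D and m
    from (0, eta] to (0, 3^k eta], dividing it by 3 at each step. *)
Lemma herglotz_vanish (R : realType) (D : R -> R) (K M : R) : 0 < K ->
  (forall s, 0 < s < 1 -> 0 <= D s) ->
  (forall s, 0 < s < 1 -> D s <= M) ->
  (forall s, 0 < s <= 1 / 2 -> D s <= K * s) ->
  (forall s, 0 < s < 1 ->
    3 * D s <= D (s / 3) + D ((s + 1) / 3) + D ((s + 2) / 3)) ->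
  forall s, 0 < s < 1 -> D s = 0.
Proof.
move=> K0 D0 DM DK D3 s s01.
pose S := [set D t | t in [set t : R | 0 < t < 1]].
have hS : has_sup S.
  split; first by exists (D s), s.
  by exists M => _ [t t01 <-]; exact: DM.
pose m := sup S.
have Dm t : 0 < t < 1 -> D t <= m.
  by move=> t01; apply: sup_upper_bound => //; exists t.
apply/eqP; rewrite eq_le D0// andbT leNgt; apply/negP => Ds0.
have m0 : 0 < m by apply: lt_le_trans (Dm _ s01).
(* Below [eta] the linear bound gives D t <= K t <= m/2, which starts the induction; the cap 1/2
   keeps t where that bound is assumed. *)
pose eta := Num.min (1 / 2) (m / (2 * K)).
have eta0 : 0 < eta by rewrite /eta lt_min !divr_gt0 ?mulr_gt0.
have gap k t : 0 < t < 1 -> t <= eta * 3 ^+ k -> D t <= m - m / 2 / 3 ^+ k.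
  elim: k t => [|k IH] t t01 tk.
    rewrite expr0 mulr1 in tk; rewrite expr0 divr1.
    move/andP: t01 => [t0 t1].
    have t2 : t <= 1 / 2 by rewrite (le_trans tk)// ge_min lexx.
    have tm : t <= m / (2 * K) by rewrite (le_trans tk)// ge_min lexx orbT.
    have := DK t; rewrite t0 t2 => /(_ isT) h; apply: (le_trans h).
    have : K * t <= K * (m / (2 * K)) by rewrite ler_pM2l.
    rewrite (_ : K * (m / (2 * K)) = m / 2); first lra.
    by field; rewrite lt0r_neq0.
  move/andP: (t01) => [t0 t1].
  have h1 : D (t / 3) <= m - m / 2 / 3 ^+ k.
    apply: IH; first by apply/andP; split; lra.
    by rewrite ler_pdivrMr// -mulrA -exprSr.
  have h2 : D ((t + 1) / 3) <= m by apply: Dm; apply/andP; split; lra.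
  have h3 : D ((t + 2) / 3) <= m by apply: Dm; apply/andP; split; lra.
  have h4 := D3 _ t01.
  have -> : m / 2 / 3 ^+ k.+1 = (m / 2 / 3 ^+ k) / 3.
    by rewrite exprS; field; rewrite expf_neq0//.
  lra.
(* Since 3^k > k, some k makes the gap hold on all of (0, 1), which contradicts the choice of m as a
   supremum. *)
have [k hk] : exists k, 1 <= eta * 3 ^+ k.
  exists (Num.truncn eta^-1).+1.
  rewrite -ler_pdivrMl// mulr1.
  apply: (@le_trans _ _ (Num.truncn eta^-1).+1%:R).
    by apply/ltW/truncnS_gt; rewrite ?num_real.
  rewrite -natrX ler_nat ltnW//; exact: ltn_expl.
have : m <= m - m / 2 / 3 ^+ k.
  rewrite {1}/m; apply: ge_sup; first by exists (D s), s.
  move=> _ [t t01 <-]; apply: gap => //.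
  by move/andP: t01 => [_ t1]; rewrite (le_trans (ltW t1)).
have : 0 < m / 2 / 3 ^+ k by rewrite !divr_gt0 ?exprn_gt0.
by lra.
Qed.

(** With x = pi s < 2, the cubic bound gives both sin x >= x/3 and x - sin x <= x^3/6, so pi / sin x
    - pi / x <= pi x / 2 = pi^2 s / 2. As pi < 4 this is at most 8s; the constant 32 is the one that
    [beta_int_bounds] requires. *)
Lemma csc_bounds (R : realType) (s : R) : 0 < s <= 1 / 2 ->
  s^-1 <= pi / sin (pi * s) <= s^-1 + 32 * s.
Proof.
move=> /andP[s0 s2].
have pi0 := pi_gt0 R; have pi4 : pi < 4 :> R by have := @pihalf_lt2 R; lra.
set x := pi * s.
have x0 : 0 < x by rewrite mulr_gt0.
have x2 : x < 2 by rewrite /x; nra.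
have h1 := sin_ge_cubic (ltW x0).
have h2 : sin x <= x.
  have [c _ E] := @MVT R sin cos _ _ x0
    (fun z _ => is_derive_sin z) (continuous_subspaceT (@continuous_sin R)).
  move: E; rewrite sin0 !subr0 => ->.
  by rewrite ler_piMl ?cos_le1// ltW.
have h3 : x / 3 <= sin x.
  apply: le_trans h1.
  have : x * (x * x) <= x * 4 by rewrite ler_pM2l//; nra.
  rewrite exprS expr2; lra.
have sx0 : 0 < sin x by lra.
have -> : s^-1 = pi / x by rewrite /x; rewrite invfM mulrA divff ?mul1r ?lt0r_neq0.
apply/andP; split.
  by rewrite ler_pM2l// lef_pV2.
rewrite -lerBlDl.
have -> : pi / sin x - pi / x = pi * ((x - sin x) / (x * sin x)).
  by field; rewrite !lt0r_neq0.
have h4 : (x - sin x) / (x * sin x) <= x / 2.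
  rewrite ler_pdivrMr ?mulr_gt0//.
  have : x / 2 * (x * (x / 3)) <= x / 2 * (x * sin x).
    by rewrite ler_pM2l ?divr_gt0// ler_pM2l.
  move: h1; rewrite exprS expr2; lra.
apply: (le_trans (ler_wpM2l (ltW pi0) h4)).
have : pi * pi <= 16 :> R by nra.
by move=> /(ler_wpM2r (ltW s0)); rewrite /x; lra.
Qed.

(** * Size of the beta integral near s = 0 *)

Lemma integral_expRN (R : realType) (c : R) : 0 < c ->
  (\int[lebesgue_measure]_(t in `[0%R, +oo[) (expR (- c * t))%:E = (c^-1)%:E)%E.
Proof.
move=> c0.
have ce : continuous (fun t : R => expR (- c * t)) by exact: continuous_expRM.
have de (t : R) : is_derive t 1 (fun t : R => - (c^-1 * expR (- c * t))) (expR
    (- c * t)).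
  apply: is_derive_eq.
  rewrite /GRing.scale/=; field; exact: lt0r_neq0.
rewrite (@ge0_continuous_FTC2y _ _ (fun t : R => - (c^-1 * expR (- c * t))) 0 0).
- by rewrite mulr0 expR0 mulr1 -EFinB sub0r opprK.
- by move=> t _; exact: expR_ge0.
- exact: continuous_subspaceT.
- rewrite -oppr0; apply: cvgN; rewrite -(mulr0 c^-1); apply: cvgM;
    first exact: cvg_cst.
  under eq_fun do rewrite mulNr.
  apply: (cvg_comp (fun t => c * t) (fun t => expR (- t)) _ (@cvgr_expR R)).
  by apply: gt0_cvgMry.
- by move=> t _; exact: ex_derive.
- apply: cvg_at_right_filter; apply: cvgN; apply: cvgM; first exact: cvg_cst.
  exact: ce.
- by move=> t _; rewrite derive1E derive_val.
Qed.

(** This isolates [expR (- s * t)], whose integral is the leading term 1/s; the remainder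
    contributes only O(s). *)
Lemma beta_kernel_fold (R : realType) (s t : R) :
  beta_kernel s t + beta_kernel (1 - s) t =
  expR (- s * t) + (expR (s * t) - expR (- s * t)) / (1 + expR t).
Proof.
rewrite /beta_kernel mulrBl mul1r expRD mulNr.
have := expR_gt0 t; move: (expR t) (expR (s * t)) (expR _) => a b c a0.
by field; rewrite lt0r_neq0//; lra.
Qed.

(** The remainder in [beta_kernel_fold] is nonnegative. Its numerator is e^(st) (1 - e^(-2st)) <=
    e^(t/2) 2st <= 8s e^(t/2) e^(t/4), so after division by 1 + e^t >= e^t it is at most 8s
    e^(-t/4), with integral 32s. *)
Lemma beta_int_bounds (R : realType) (s : R) : 0 < s <= 1 / 2 ->
  ((s^-1)%:E <= beta_int s <= (s^-1 + 32 * s)%:E)%E.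
Proof.
move=> /andP[s0 s2]; rewrite beta_int_fold -(integral_expRN s0).
have me (c : R) (D : set R) : measurable_fun D (fun t : R => expR (c * t)).
  by apply: measurable_funTS; apply: continuous_measurable_fun;
      exact: continuous_expRM.
have mk : measurable_fun (`[0, +oo[%classic : set R)
    (fun t : R => (beta_kernel s t + beta_kernel (1 - s) t)%:E).
  by apply/measurable_EFinP; apply: measurable_funD; exact: measurable_beta_kernel.
apply/andP; split.
  apply: ge0_le_integral => //.
  - by apply/measurable_EFinP; exact: me.
  - move=> t; rewrite /= in_itv/= andbT => t0;
      rewrite lee_fin beta_kernel_fold lerDl.
    apply: divr_ge0; last by rewrite addr_ge0 ?expR_ge0.
    by rewrite subr_ge0 ler_expR; nra.
rewrite EFinD.
have -> : 32 * s = 8 * s * (1 / 4)^-1 by field.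
rewrite EFinM -(integral_expRN s0) -(@integral_expRN _ (1 / 4)) ?divr_gt0//.
rewrite -ge0_integralZl//; last 2 first.
- by apply/measurable_EFinP; exact: me.
- by rewrite lee_fin; lra.
under [X in (_ <= _ + X)%E]eq_integral do rewrite -EFinM.
have p2 (t : R) : 0 <= 8 * s * expR (- (1 / 4) * t).
  by rewrite mulr_ge0 ?expR_ge0//; lra.
have m2 (D : set R) : measurable_fun D (fun t : R => 8 * s * expR (- (1 / 4) * t)).
  by apply: measurable_funM => //; exact: me.
rewrite -(ge0_integralD_EFin (measurable_itv `[0, +oo[)
  (fun t => expR_ge0 (- s * t)) p2 (me _ _) (m2 _)).
apply: ge0_le_integral => //.
- by move=> t _; rewrite lee_fin addr_ge0 ?beta_kernel_ge0.
- apply/measurable_EFinP; apply: measurable_funD; first exact: me.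
  exact: m2.
move=> t; rewrite /= in_itv/= andbT => t0; rewrite lee_fin beta_kernel_fold lerD2l.
have e1 : expR (- s * t) = expR (s * t) * expR (- (2 * s * t)).
  by rewrite -expRD; congr expR; ring.
have e2 := expR_ge1Dx (- (2 * s * t)).
have e3 : expR (s * t) <= expR (t / 2) by rewrite ler_expR; nra.
have e4 := expR_ge1Dx (t / 4).
have e5 : expR (- (1 / 4) * t) = expR (t / 2) * expR (t / 4) / expR t.
  by rewrite -expRN -!expRD; congr expR; field.
rewrite e5 e1.
have p := @expR_gt0 R.
have := p t; have := p (s * t); have := p (t / 2).
move: (expR t) (expR (s * t)) (expR (t / 2)) (expR _) (expR (t / 4)) e2 e3 e4.
move=> a b c d e e2 e3 e4 c0 b0 a0.
have h1 : b - b * d <= b * (2 * s * t) by nra.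
have h2 : b * (2 * s * t) <= c * (2 * s * t) by apply: ler_wpM2r => //; nra.
have h3 : c * (2 * s * t) <= c * (8 * s * e).
  by apply: ler_wpM2l; [exact: ltW|nra].
have h4 : (b - b * d) / (1 + a) <= c * (8 * s * e) / (1 + a).
  by rewrite ler_pM2r ?invr_gt0; lra.
apply: (le_trans h4).
rewrite (_ : 8 * s * (c * e / a) = c * (8 * s * e) / a); last first.
  by field; rewrite lt0r_neq0.
have : 0 <= c * (8 * s * e) by apply: mulr_ge0; [exact: ltW|apply: mulr_ge0; lra].
by move=> ?; apply: ler_wpM2l => //; rewrite lef_pV2 ?posrE; lra.
Qed.

Lemma beta_int_fin_num (R : realType) (s : R) : 0 < s < 1 ->
  beta_int s \is a fin_num.
Proof.
have h (t : R) : 0 < t <= 1 / 2 -> beta_int t \is a fin_num.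
  by move=> /beta_int_bounds /andP[h1 h2];
      rewrite fin_numElt (lt_le_trans _ h1) ?ltNyr// (le_lt_trans h2) ?ltry.
move=> /andP[s0 s1]; have [s2|s2] := leP s (1 / 2); first by rewrite h ?s0.
by rewrite -beta_int_sym h//; apply/andP; split; lra.
Qed.

Theorem beta_reflection (R : realType) (s : R) : 0 < s < 1 ->
  beta_int s = (pi / sin (pi * s))%:E.
Proof.
pose f (t : R) := fine (beta_int t).
pose D (t : R) := `|f t - pi / sin (pi * t)|.
have pi0 := pi_gt0 R.
have fin (v : R) : 0 < v < 1 -> beta_int v = (f v)%:E.
  by move=> v01; rewrite fineK// beta_int_fin_num.
have Dsym t : D (1 - t) = D t.
  rewrite /D /f beta_int_sym; congr (`| _ - _ / _ |).
  by rewrite mulrBr mulr1 sinB sinpi cospi; ring.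
have DK (t : R) : 0 < t <= 1 / 2 -> D t <= 32 * t.
  move=> t2; have /andP[h1 h2] := beta_int_bounds t2.
  have /andP[h3 h4] := csc_bounds t2.
  have t01 : 0 < t < 1 by move/andP: t2 => [? ?]; apply/andP; split; lra.
  rewrite fin// !lee_fin in h1 h2.
  by rewrite /D ler_norml; apply/andP; split; lra.
move=> s01; rewrite fin//; congr EFin.
apply/eqP; rewrite -subr_eq0 -normr_eq0; apply/eqP.
(* The uniform bound 16 is 32 * (1/2), carried to the upper half of (0, 1) by [Dsym]. *)
apply: (@herglotz_vanish R D 32 16) => //.
- by move=> t _; exact: normr_ge0.
- move=> t /andP[t0 t1]; have [t2|t2] := leP t (1 / 2).
    by have := DK t; rewrite t0 t2 => /(_ isT); lra.
  by rewrite -Dsym; have := DK (1 - t); rewrite (_ : 0 < 1 - t <= 1 / 2);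
    [move=> /(_ isT); lra|apply/andP; split; lra].
(* Both functions satisfy the same functional equation, so their difference does too; the triangle
   inequality removes the minus sign on the middle term. *)
- move=> t /andP[t0 t1].
  have h := beta_int_triple t.
  rewrite !fin in h; [|by apply/andP; split; lra..].
  move: h; rewrite -EFinM -!EFinD => -[].
  have ptpi : 0 < pi * t < pi by rewrite mulr_gt0//= gtr_pMr.
  have := csc_triple ptpi.
  have -> : pi * t / 3 = pi * (t / 3) by ring.
  have -> : (pi * t + 2 * pi) / 3 = pi * ((t + 2) / 3) by ring.
  have -> : (pi * t + pi) / 3 = pi * ((t + 1) / 3) by ring.
  move=> /(congr1 (fun z => pi * z)) hc hf.
  rewrite /D -[X in X * _](@ger0_norm _ 3)// -normrM.
  set c1 := sin (pi * (t / 3)) in hc *; set c2 := sin (pi * ((t + 1) / 3)) in hc *.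
  set c3 := sin (pi * ((t + 2) / 3)) in hc *.
  rewrite (_ : 3 * _ = (f (t / 3) - pi / c1) -
    (f ((t + 1) / 3) - pi / c2) +
    (f ((t + 2) / 3) - pi / c3)); last first.
    move: hf hc; rewrite !mulrDr.
    by move: (f t) (f _) (f _) (f _) => f0 f1 f2 f3; lra.
  by rewrite (le_trans (ler_normD _ _))// lerD2r (le_trans (ler_normB _ _)).
Qed.

(** * The two kernels *)

Lemma is_derive_continuous (R : realType) (f : R -> R) (x l : R) :
  is_derive x 1 f l -> {for x, continuous f}.
Proof.
by move=> ?; apply: differentiable_continuous; apply/derivable1_diffP;
    exact: ex_derive.
Qed.

(** An improper integral is exhausted by compact intervals: the fundamental theorem applies on each,
    and monotone convergence passes to the union. Bounding the increments of F avoids computing its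
    limits at the ends. *)
Lemma ge0_integral_FTC_le (R : realType) (f F : R -> R) (c d : nat -> R) (B : R) :
  (forall k, c k < d k) -> (forall k, c k.+1 <= c k) -> (forall k, d k <= d k.+1) ->
  (forall k x, c k <= x <= d k ->
    [/\ 0 <= f x, is_derive x 1 F (f x) & {for x, continuous f}]) ->
  (forall k, F (d k) - F (c k) <= B) ->
  (\int[lebesgue_measure]_(x in \bigcup_k `[c k, d k]%classic) (f x)%:E <= B%:E)%E.
Proof.
move=> cd cS dS fF FB.
have cf k : {within `[c k, d k], continuous f}.
  apply: continuous_in_subspaceT => x; rewrite inE/= in_itv/= => xk.
  by have [] := fF k x xk.
have cF k x : c k <= x <= d k -> {for x, continuous F}.
  by move=> /(fF k) [_ h _]; exact: is_derive_continuous h.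
have h : (\int[lebesgue_measure]_(x in `[c k, d k]) (f x)%:E)%E @[k --> \oo] -->
    (\int[lebesgue_measure]_(x in \bigcup_k `[c k, d k]%classic) (f x)%:E)%E.
  apply: ge0_nondecreasing_set_cvg_integral.
  - apply/nondecreasing_seqP => k; apply/subsetPset => x /=.
    by rewrite !in_itv/= => /andP[h1 h2];
        rewrite (le_trans (cS k))//= (le_trans h2).
  - by move=> k; exact: measurable_itv.
  - move=> k; apply/measurable_EFinP.
    exact: subspace_continuous_measurable_fun (measurable_itv _) (cf k).
  - by move=> k x /=; rewrite in_itv/= lee_fin => /(fF k) [].
rewrite -(cvg_lim _ h)//; apply: lime_le; first by apply/cvg_ex; eexists; exact: h.
near=> k.
rewrite (@continuous_FTC2 _ f F)//.
- by rewrite -EFinB lee_fin.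
- split.
  + move=> x; rewrite in_itv/= => /andP[x1 x2].
    by have [|_ hd _] := fF k x; [rewrite !ltW|exact: ex_derive].
  + by apply: cvg_at_right_filter; apply: (cF k); rewrite lexx ltW.
  + by apply: cvg_at_left_filter; apply: (cF k); rewrite lexx ltW.
- move=> x; rewrite in_itv/= => /andP[x1 x2].
  by have [|_ hd _] := fF k x; [rewrite !ltW|rewrite derive1E derive_val].
Unshelve. all: by end_near. Qed.

Lemma bigcup_itv_oy (R : realType) (r : R) :
  \bigcup_k `[r + k.+1%:R^-1, r + k.+2%:R]%classic = `]r, +oo[%classic.
Proof.
apply/seteqP; split => x.
  move=> [k _]; rewrite /= !in_itv/= andbT => /andP[+ _]; apply: lt_le_trans.
  by rewrite ltrDl.
rewrite /= in_itv/= andbT => rx.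
(* The index must exceed 1/(x - r) for the left endpoint and x - r for the right one. *)
pose a := (x - r)^-1; pose b := x - r.
exists (Num.truncn (Num.max a b)).+1 => //=.
have xr : 0 < x - r by rewrite subr_gt0.
have m0 : 0 <= Num.max a b by rewrite le_max /b (ltW xr) orbT.
have h : Num.max a b < (Num.truncn (Num.max a b)).+1%:R by exact: truncnS_gt.
have : (Num.truncn (Num.max a b)).+1%:R <= (Num.truncn (Num.max a b)).+2%:R :> R
    by rewrite ler_nat.
have : (Num.truncn (Num.max a b)).+1%:R <= (Num.truncn (Num.max a b)).+3%:R :> R
    by rewrite ler_nat ltnW.
move: h; rewrite gt_max => /andP[ha hb] h2 h1; rewrite in_itv/= -lerBrDl;
    apply/andP; split.
  rewrite -[leRHS]invrK lef_pV2 ?posrE ?invr_gt0//.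
  by rewrite ltW// (lt_le_trans ha).
by rewrite -lerBlDl ltW// (lt_le_trans hb).
Qed.

Lemma bigcup_itv_0r (R : realType) (r : R) : 0 < r ->
  \bigcup_k `[r / k.+2%:R, r]%classic = `]0, r]%classic.
Proof.
move=> r0; apply/seteqP; split => x.
  move=> [k _]; rewrite /= !in_itv/= => /andP[+ ->]; rewrite andbT;
      apply: lt_le_trans.
  by rewrite divr_gt0.
rewrite /= in_itv/= => /andP[x0 xr].
exists (Num.truncn (r / x)) => //=; rewrite in_itv/= xr andbT.
rewrite ler_pdivrMr// mulrC -ler_pdivrMr// ltW//.
have h : r / x < (Num.truncn (r / x)).+1%:R by exact: truncnS_gt.
by rewrite (lt_le_trans h)// ler_nat.
Qed.

(** Split (a + b)^p = a (a + b)^(p-1) + b (a + b)^(p-1); since p - 1 <= 0, shrinking the base to a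
    or to b only increases each term. *)
Lemma powR_subadditive (R : realType) (a b p : R) : 0 < a -> 0 < b -> 0 < p <= 1 ->
  (a + b) `^ p <= a `^ p + b `^ p.
Proof.
move=> a0 b0 /andP[p0 p1].
have h (x y : R) : 0 < x -> 0 < y -> x * (x + y) `^ (p - 1) <= x `^ p.
  move=> x0 y0; rewrite -[leRHS]mulr_powRB1 ?(ltW x0)// ler_pM2l//.
  rewrite -[p - 1]opprK !(powRN _ (- _)) lef_pV2 ?posrE ?powR_gt0 ?addr_gt0//.
  by apply: ge0_ler_powR; rewrite ?nnegrE ?addr_ge0 ?(ltW x0) ?(ltW y0)//
      ?lerDl ?(ltW y0)//; lra.
rewrite -[leLHS]mulr_powRB1 ?addr_ge0 ?(ltW a0) ?(ltW b0)// mulrDl.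
by rewrite lerD ?h// addrC h.
Qed.

Lemma continuous_powR (R : realType) (p : R) (g : R -> R) (x : R) :
  0 < g x -> {for x, continuous g} -> {for x, continuous (fun y => g y `^ p)}.
Proof.
move=> g0 cg; apply: (@continuous_comp _ _ _ g (fun z : R => z `^ p) x cg).
exact: is_derive_continuous (is_derive1_powR p g0).
Qed.

Lemma is_derive_powR_comp (R : realType) (p : R) (g : R -> R) (x b : R) :
  0 < g x -> is_derive x 1 g b ->
  is_derive x 1 (fun y => g y `^ p) (p * g x `^ (p - 1) * b).
Proof.
move=> g0 db.
have h := @is_derive1_comp R (fun y : R => y `^ p) g x _ _
    (is_derive1_powR p g0) db.
exact: h.
Qed.

(** * The two error integrals, by explicit primitives *)

Lemma is_derive_sqrM (R : realType) (x : R) :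
  is_derive x 1 (fun y : R => y ^+ 2) (2 * x).
Proof. by apply: is_derive_eq; rewrite /GRing.scale/=; ring. Qed.

(** In this form the nonlocal kernel differs from the mean kernel only by x^2 in place of x^2 -
    r^2. *)
Lemma powR_1D2 (R : realType) (s x : R) : 0 < x ->
  x `^ (1 + 2 * s) = x * (x ^+ 2) `^ s.
Proof.
move=> x0; rewrite powRD ?lt0r_neq0 ?implybT// powRr1 ?ltW//.
by rewrite powRrM powR_mulrn// ltW.
Qed.

Lemma powR_2M (R : realType) (s x : R) : 0 <= x ->
  x `^ (2 * s) = (x ^+ 2) `^ s.
Proof. by move=> x0; rewrite powRrM powR_mulrn. Qed.

(** The integrand is x (x^2)^(-s), with primitive (x^2)^(1-s) / (2(1-s)); the latter is nonnegative,
    so its increments up to r are at most its value at r. *)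
Lemma integral_near_origin_le (R : realType) (s r : R) : 0 < s < 1 -> 0 < r ->
  (\int[lebesgue_measure]_(x in `]0%R, r]) (x ^+ 2 / x `^ (1 + 2 * s))%:E <=
   ((r ^+ 2) `^ (1 - s) / (2 * (1 - s)))%:E)%E.
Proof.
move=> /andP[s0 s1] r0;
pose f (x : R) := x * (x ^+ 2) `^ (- s).
pose F (x : R) := (x ^+ 2) `^ (1 - s) / (2 * (1 - s)).
rewrite (_ : integral _ _ _ = \int[lebesgue_measure]_(x in `]0%R, r])
    (f x)%:E)%E; last first.
  apply: eq_integral => x; rewrite inE/= in_itv/= => /andP[x0 _]; congr EFin.
  rewrite powR_1D2// /f powRN expr2; field.
  by rewrite !lt0r_neq0// powR_gt0// mulr_gt0.
rewrite -bigcup_itv_0r//.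
apply: (ge0_integral_FTC_le (F := F)).
- by move=> k; rewrite ltr_pdivrMr// ltr_pMr// ltr1n.
- by move=> k; rewrite ler_pM2l// lef_pV2 ?posrE// ler_nat.
- by [].
- move=> k x /andP[h _].
  have x0 : 0 < x by apply: lt_le_trans h; rewrite divr_gt0.
  have q0 : 0 < x ^+ 2 by rewrite exprn_gt0.
  split.
  + by rewrite /f mulr_ge0 ?powR_ge0 ?ltW.
  + have hd := @is_derive_powR_comp _ (1 - s) (fun y : R => y ^+ 2) _ _ q0
      (is_derive_sqrM x).
    have -> : F = (2 * (1 - s))^-1 \*: (fun y : R => (y ^+ 2) `^ (1 - s)).
      by apply/funext => y; rewrite /F/= mulrC.
    apply: is_derive_eq; rewrite /f /GRing.scale/= (_ : 1 - s - 1 = - s);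
        last by ring.
    by field; rewrite lt0r_neq0//; lra.
  + apply: (@continuousM _ _ (fun y => y)); first exact: cvg_id.
    exact: (@continuous_powR _ _ (fun y : R => y ^+ 2) _ q0
        (is_derive_continuous (is_derive_sqrM x))).
- move=> k; rewrite lerBlDl /F lerDr.
  by rewrite divr_ge0 ?powR_ge0//; lra.
Qed.

(** The primitive F is ((x^2 - r^2)^(1-s) - (x^2)^(1-s)) / (2(1-s)). It is nonpositive, and
    subadditivity of the power 1 - s applied to x^2 = (x^2 - r^2) + r^2 bounds -F by the right-hand
    side, so F d - F c is bounded without any limit at infinity. *)
Lemma integral_kernel_diff_le (R : realType) (s r : R) : 0 < s < 1 -> 0 < r ->
  (\int[lebesgue_measure]_(x in `]r, +oo[)
     (x ^+ 2 * (((x ^+ 2 - r ^+ 2) `^ s * x)^-1 - (x `^ (1 + 2 * s))^-1))%:E <=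
   ((r ^+ 2) `^ (1 - s) / (2 * (1 - s)))%:E)%E.
Proof.
move=> /andP[s0 s1] r0.
pose f (x : R) := x * ((x ^+ 2 - r ^+ 2) `^ (- s) - (x ^+ 2) `^ (- s)).
pose F (x : R) := ((x ^+ 2 - r ^+ 2) `^ (1 - s) - (x ^+ 2) `^ (1 - s)) / (2 *
    (1 - s)).
have sq (x : R) : r < x -> 0 < x ^+ 2 - r ^+ 2 by move=> rx;
    rewrite subr_gt0 ltr_sqr ?nnegrE; lra.
rewrite (_ : integral _ _ _ = \int[lebesgue_measure]_(x in `]r, +oo[)
    (f x)%:E)%E; last first.
  apply: eq_integral => x; rewrite inE/= in_itv/= andbT => rx; congr EFin.
  have x0 : 0 < x by lra.
  rewrite powR_1D2// /f !powRN.
  have := powR_gt0 s (sq _ rx); have := @powR_gt0 _ (x ^+ 2) s (exprn_gt0 _ x0).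
  move: (_ `^ s) (_ `^ s) => a b a0 b0.
  by field; rewrite !lt0r_neq0.
rewrite -bigcup_itv_oy.
have c0 k : r < r + k.+1%:R^-1 by rewrite ltrDl.
apply: (ge0_integral_FTC_le (F := F)).
- move=> k; rewrite ltrD2l (@le_lt_trans _ _ 1)// ?ltr1n//.
  by rewrite invf_le1// ler1n.
- by move=> k; rewrite lerD2l lef_pV2 ?posrE// ler_nat.
- by move=> k; rewrite lerD2l ler_nat.
- move=> k x /andP[h _].
  have rx : r < x by apply: lt_le_trans h.
  have x0 : 0 < x by apply: lt_trans rx.
  have q0 : 0 < x ^+ 2 by rewrite exprn_gt0.
  have q1 := sq _ rx.
  have d1 := is_derive_sqrM x.
  have d2 : is_derive x 1 (fun y : R => y ^+ 2 - r ^+ 2) (2 * x).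
    by apply: is_derive_eq; rewrite subr0.
  split.
  + rewrite /f mulr_ge0 ?(ltW x0)// subr_ge0 !powRN lef_pV2 ?posrE ?powR_gt0//.
    by apply: (ge0_ler_powR (ltW s0));
        rewrite ?nnegrE ?(ltW q0) ?(ltW q1)// gerBl sqr_ge0.
  + have h1 := @is_derive_powR_comp _ (1 - s) (fun y : R => y ^+ 2) _ _ q0 d1.
    have h2 := @is_derive_powR_comp _ (1 - s) (fun y : R => y ^+ 2 - r ^+ 2) _
        _ q1 d2.
    have -> : F = (2 * (1 - s))^-1 \*: ((fun y : R => (y ^+ 2 - r ^+ 2) `^ (1 - s))
        -
         (fun y : R => (y ^+ 2) `^ (1 - s))).
      by apply/funext => y; rewrite /F/= mulrC.
    apply: is_derive_eq; rewrite /f /GRing.scale/= (_ : 1 - s - 1 = - s);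
        last by ring.
    by field; rewrite lt0r_neq0//; lra.
  + apply: (@continuousM _ _ (fun y => y)); first exact: cvg_id.
    apply: cvgB.
      exact: (@continuous_powR _ _ (fun y : R => y ^+ 2 - r ^+ 2) _ q1
          (is_derive_continuous d2)).
    exact: (@continuous_powR _ _ (fun y : R => y ^+ 2) _ q0
        (is_derive_continuous d1)).
- move=> k; set c := r + k.+1%:R^-1; set d := r + k.+2%:R.
  have e0 : 0 < (2 * (1 - s))^-1 by rewrite invr_gt0; lra.
  have rc : r < c by exact: c0.
  have rd : r < d by rewrite ltrDl.
  have Fd : F d <= 0.
    rewrite /F pmulr_lle0// subr_le0.
    have s1' : 0 <= 1 - s by lra.
    by apply: (ge0_ler_powR s1');
        rewrite ?nnegrE ?sqr_ge0 ?(ltW (sq _ rd))// gerBl sqr_ge0.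
  have : - F c <= (r ^+ 2) `^ (1 - s) / (2 * (1 - s)).
    rewrite /F -mulNr ler_pM2r// opprB lerBlDl.
    rewrite -[X in X `^ _ <= _](subrK (r ^+ 2)).
    by apply: powR_subadditive; [exact: sq|exact: exprn_gt0|apply/andP; split; lra].
  lra.
Qed.

(** G may blow up at r, so the substitution is made on the compact intervals [-(k+1), k+1] and their
    images; monotone convergence on both sides gives the improper version. *)
Lemma ge0_integral_subst_oy (R : realType) (phi dphi G : R -> R) (r : R) :
  {homo phi : x y / x < y} ->
  (forall t : R, is_derive t (1 : R) phi (dphi t)) ->
  continuous dphi ->
  (forall t, r < phi t) ->
  (forall x, r < x -> exists k : nat, phi (- k.+1%:R) <= x <= phi k.+1%:R) ->
  {in `]r, +oo[, continuous G} ->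
  (forall x, r < x -> 0 <= G x) ->
  (\int[lebesgue_measure]_(x in `]r, +oo[) (G x)%:E =
   \int[lebesgue_measure]_t (G (phi t) * dphi t)%:E)%E.
Proof.
move=> hphi dphiP cdphi rphi surj cG G0.
have cphi : continuous phi by move=> t; exact: is_derive_continuous (dphiP t).
have D : derive1 phi = dphi by apply/funext => t; rewrite derive1E derive_val.
have mono a b : a <= b -> phi a <= phi b.
  by rewrite le_eqVlt => /predU1P[->//|/hphi/ltW].
have dphi0 t : 0 <= dphi t.
  rewrite -D; apply: (@incr_derive1_ge0 _ phi setT); rewrite ?interiorT//.
  by move=> x y _ _; exact: hphi.
have cc : continuous (fun t => G (phi t) * dphi t).
  move=> t; apply: continuousM; last exact: cdphi.
  apply: continuous_comp; first exact: cphi.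
  by apply: cG; rewrite in_itv/= rphi.
have nk (k : nat) : - k.+1%:R < k.+1%:R :> R.
  by rewrite (@lt_trans _ _ 0)// oppr_lt0.
have E1 : \bigcup_k `[phi (- k.+1%:R), phi k.+1%:R]%classic = `]r, +oo[%classic.
  apply/seteqP; split => x.
    move=> [k _]; rewrite /= !in_itv/= andbT => /andP[+ _]; exact: lt_le_trans.
  rewrite /= in_itv/= andbT => /surj[k hk].
  by exists k => //=; rewrite in_itv.
have E2 : \bigcup_k `[- k.+1%:R, k.+1%:R]%classic = [set: R].
  apply/seteqP; split => x // _; exists (Num.truncn `|x|) => //=.
  by rewrite in_itv/= -ler_norml ltW// truncnS_gt.
have h1 : (\int[lebesgue_measure]_(x in `[phi (- k.+1%:R)%R, phi k.+1%:R])
      (G x)%:E)%E @[k --> \oo] -->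
    (\int[lebesgue_measure]_(x in \bigcup_k
      `[phi (- k.+1%:R)%R, phi k.+1%:R]%classic) (G x)%:E)%E.
  apply: ge0_nondecreasing_set_cvg_integral.
  - apply/nondecreasing_seqP => k; apply/subsetPset => x /=.
    rewrite !in_itv/= => /andP[x1 x2]; apply/andP; split.
      by apply: le_trans x1; apply: mono; rewrite lerN2 ler_nat.
    by apply: (le_trans x2); apply: mono; rewrite ler_nat.
  - by move=> k; exact: measurable_itv.
  - move=> k; apply/measurable_EFinP.
    apply: (@measurable_funS _ _ _ _ `]r, +oo[%classic) => //.
      by move=> x; rewrite /= !in_itv/= andbT => /andP[+ _]; exact: lt_le_trans.
    by apply: open_continuous_measurable_fun => // x; rewrite inE => /cG.
  - move=> k x /=; rewrite in_itv/= lee_fin => /andP[x1 _].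
    by rewrite G0// (lt_le_trans _ x1).
have h2 : (\int[lebesgue_measure]_(t in `[(- k.+1%:R)%R, k.+1%:R])
      (G (phi t) * dphi t)%:E)%E @[k --> \oo] -->
    (\int[lebesgue_measure]_(t in \bigcup_k `[(- k.+1%:R)%R, k.+1%:R]%classic)
        (G (phi t) * dphi t)%:E)%E.
  apply: ge0_nondecreasing_set_cvg_integral.
  - apply/nondecreasing_seqP => k; apply/subsetPset => x /=.
    rewrite !in_itv/= => /andP[x1 x2]; apply/andP; split.
      by apply: le_trans x1; rewrite lerN2 ler_nat.
    by apply: (le_trans x2); rewrite ler_nat.
  - by move=> k; exact: measurable_itv.
  - move=> k; apply/measurable_EFinP; apply: measurable_funTS.
    exact: continuous_measurable_fun.
  - by move=> k x _; rewrite lee_fin mulr_ge0// G0.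
have Ek : (fun k : nat => \int[lebesgue_measure]_(x in
      `[phi (- k.+1%:R)%R, phi k.+1%:R]) (G x)%:E)%E =
    (fun k : nat => \int[lebesgue_measure]_(t in `[(- k.+1%:R)%R, k.+1%:R])
        (G (phi t) * dphi t)%:E)%E.
  apply/funext => k.
  rewrite (@integration_by_substitution_increasing _ phi).
  - by apply: eq_integral => t _; rewrite fctE D.
  - exact/ltW/nk.
  - by move=> x y _ _; exact: hphi.
  - by move=> x _; rewrite D; exact: cdphi.
  - by rewrite D; apply/cvg_ex; eexists; apply: cvg_at_right_filter; exact: cdphi.
  - by rewrite D; apply/cvg_ex; eexists; apply: cvg_at_left_filter; exact: cdphi.
  - split.
    + by move=> x _; exact: ex_derive.
    + by apply: cvg_at_right_filter; exact: cphi.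
    + by apply: cvg_at_left_filter; exact: cphi.
  - apply: continuous_in_subspaceT => x; rewrite inE/= in_itv/= => /andP[x1 _].
    by apply: cG; rewrite in_itv/= andbT (lt_le_trans _ x1).
rewrite Ek in h1.
by rewrite -E1 -[in RHS]E2 -(cvg_lim _ h1)// -(cvg_lim _ h2).
Qed.

(** Under x = r sqrt (1 + e^t) one has x^2 - r^2 = r^2 e^t and dx/x = e^t / (2 (1 + e^t)) dt, so the
    integrand becomes r^(-2s) / 2 times [beta_kernel (1 - s)]. *)
Lemma integral_mean_kernel (R : realType) (s r : R) : 0 < s < 1 -> 0 < r ->
  (\int[lebesgue_measure]_(x in `]r, +oo[) (((x ^+ 2 - r ^+ 2) `^ s * x)^-1)%:E =
   ((r ^+ 2) `^ (- s) / 2 * (pi / sin (pi * s)))%:E)%E.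
Proof.
move=> /andP[s0 s1] r0.
pose q (t : R) := Num.sqrt (1 + expR t).
pose phi (t : R) := r * q t.
pose dphi (t : R) := r * (expR t / (2 * q t)).
have e0 := @expR_gt0 R.
have a0 (t : R) : 0 < 1 + expR t by rewrite addr_gt0.
have q0 t : 0 < q t by rewrite sqrtr_gt0.
have q2 t : q t ^+ 2 = 1 + expR t by rewrite sqr_sqrtr// ltW.
have rphi t : r < phi t.
  by rewrite ltr_pMr// -sqrtr1 ltr_sqrt// ltrDl.
have hphi : {homo phi : x y / x < y}.
  by move=> x y xy; rewrite ltr_pM2l// ltr_sqrt// ltrD2l ltr_expR.
have phi2 t : phi t ^+ 2 - r ^+ 2 = r ^+ 2 * expR t.
  by rewrite /phi exprMn q2; ring.
have dphiP (t : R) : is_derive t (1 : R) phi (dphi t).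
  have h1 : is_derive t 1 (fun u : R => 1 + expR u) (expR t).
    by rewrite -[X in is_derive _ _ _ X]add0r; apply: is_deriveD.
  have h2 := @is_derive1_comp R Num.sqrt (fun u : R => 1 + expR u) t _ _
    (is_derive1_sqrt (a0 t)) h1.
  have -> : dphi t = r *: ((2 * Num.sqrt (1 + expR t))^-1 * expR t).
    by rewrite /dphi /GRing.scale/= -/(q t) [expR t / _]mulrC.
  have -> : phi = r \*: (Num.sqrt \o (fun u : R => 1 + expR u)) by [].
  exact: is_deriveZ.
have cphi : continuous phi by move=> t; exact: is_derive_continuous (dphiP t).
have cq : continuous q.
  move=> t; apply: (@continuous_comp _ _ _ (fun u : R => 1 + expR u) Num.sqrt).
    by apply: cvgD; [exact: cvg_cst|exact: continuous_expR].
  exact: sqrt_continuous.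
rewrite (@ge0_integral_subst_oy _ phi dphi).
- rewrite EFinM -beta_reflection ?s0// -beta_int_sym /beta_int
    -ge0_integralZl//=; last 3 first.
  + by apply/measurable_EFinP; exact: measurable_beta_kernel.
  + by move=> t _; rewrite lee_fin beta_kernel_ge0.
  + by rewrite lee_fin divr_ge0 ?powR_ge0.
  apply: eq_integral => t _; rewrite -EFinM; congr EFin.
  rewrite phi2 powRM ?sqr_ge0 ?ltW// -expRM powRN /beta_kernel mulrBl mul1r expRB.
  rewrite -q2 /dphi /phi [t * s]mulrC.
  have := powR_gt0 s (exprn_gt0 2 r0); have := e0 (s * t); have := q0 t.
  move: (q t) (expR (s * t)) (expR t) (_ `^ s) => Q A E P Q0 A0 P0.
  by field; rewrite !lt0r_neq0.
- exact: hphi.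
- move=> t; apply: cvgM; first exact: cvg_cst.
  apply: cvgM; first exact: continuous_expR.
  apply: cvgV; first by rewrite lt0r_neq0// mulr_gt0.
  by apply: cvgM; [exact: cvg_cst|exact: cq].
- exact: rphi.
- move=> x rx; have x0 : 0 < x by apply: lt_trans rx.
  have w0 : 0 < x ^+ 2 / r ^+ 2 - 1.
    by rewrite subr_gt0 ltr_pdivlMr ?exprn_gt0// mul1r ltr_sqr ?nnegrE// ltW.
  (* This t is the preimage of x under [phi]. *)
  pose t := ln (x ^+ 2 / r ^+ 2 - 1).
  have et : phi t = x.
    rewrite /phi /q /t lnK ?posrE// addrC subrK -expr_div_n sqrtr_sqr.
    by rewrite ger0_norm ?divr_ge0 ?(ltW x0) ?(ltW r0)// mulrC divfK// lt0r_neq0.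
  have mono a b : a <= b -> phi a <= phi b.
    by rewrite le_eqVlt => /predU1P[->//|/hphi/ltW].
  exists (Num.truncn `|t|); rewrite -et.
  have : `|t| <= (Num.truncn `|t|).+1%:R by rewrite ltW// truncnS_gt.
  by rewrite ler_norml => /andP[h1 h2]; rewrite !mono.
- move=> x; rewrite in_itv/= andbT => rx.
  have x0 : 0 < x by apply: lt_trans rx.
  have g0 : 0 < x ^+ 2 - r ^+ 2 by rewrite subr_gt0 ltr_sqr ?nnegrE ?ltW.
  have d2 : is_derive x 1 (fun y : R => y ^+ 2 - r ^+ 2) (2 * x).
    by have d1 := is_derive_sqrM x; apply: is_derive_eq; rewrite subr0.
  apply: cvgV; first by rewrite lt0r_neq0// mulr_gt0// powR_gt0.
  apply: cvgM; last exact: cvg_id.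
  exact: (@continuous_powR _ _ (fun y : R => y ^+ 2 - r ^+ 2) _ g0
      (is_derive_continuous d2)).
- move=> x rx; rewrite invr_ge0 mulr_ge0 ?powR_ge0// ltW//.
  exact: lt_trans rx.
Qed.

(** * Measurability of spherical integrals *)

Lemma measurable_coord (R : realType) (n : nat) (i : 'I_n) :
  measurable_fun setT (fun w : Rn R n => (w : 'rV[R]_n) ord0 i).
Proof.
apply: (measurability (@RGenOInfty.G R)); first exact: RGenOInfty.measurableE.
move=> _ [_ [a ->] <-]; rewrite setTI; apply: sub_sigma_algebra.
apply: (@open_comp _ _ (fun w : 'rV[R]_n => w ord0 i)) => [w _|].
  exact: coord_continuous.
by rewrite set_itvoy; exact: open_gt.
Qed.

(** An open set is the countable union of the rational sup-norm balls it
    contains. *)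
Lemma measurable_fun_Rn d (T : measurableType d) (R : realType) (n : nat)
    (f : T -> 'rV[R]_n) :
  (forall i, measurable_fun setT (fun t => f t ord0 i)) ->
  @measurable_fun _ _ T (Rn R n) setT f.
Proof.
move=> mf; apply: (@measurability _ _ T (Rn R n) setT f (@open 'rV[R]_n)) => //.
move=> _ [U oU <-]; rewrite setTI.
pose box (p : 'rV[rat]_n * nat) : set 'rV[R]_n :=
  ball (map_mx ratr p.1 : 'rV[R]_n) (p.2.+1%:R^-1).
(* Boxes that leave U are replaced by the empty set, so that the union can run over a whole
   countable type. *)
pose J p := if pselect (box p `<=` U) then f @^-1` box p else set0.
have -> : f @^-1` U = \bigcup_p J p.
  apply/seteqP; split => t /=; last first.
    by move=> [p _]; rewrite /J; case: pselect => //= h; exact: h.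
  move=> Ut; have /nbhs_ballP [e /= e0 be] : nbhs (f t) U by exact: open_nbhs_nbhs.
  (* The radius 1/(k+1) is below e/2: a box of this radius whose centre is that close to f t
     contains f t and stays within e of it. *)
  pose k := Num.truncn (2 / e).
  have k0 : (0 : R) < k.+1%:R^-1 by [].
  have ke : k.+1%:R^-1 * 2 < e.
    have : 2 / e < k.+1%:R by exact: truncnS_gt.
    by rewrite ltr_pdivrMr// => h; rewrite mulrC ltr_pdivrMr// mulrC.
  have hq (i : 'I_n) : exists q : rat, ball (f t ord0 i) (k.+1%:R^-1) (ratr q : R).
    have : f t ord0 i - k.+1%:R^-1 < f t ord0 i + k.+1%:R^-1 by rewrite ltrD2l gtrN.
    move=> /rat_in_itvoo[q]; rewrite in_itv/= => /andP[q1 q2]; exists q.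
    by rewrite /ball/= ltr_distlC q1.
  have /choice [q hq'] := hq.
  exists (\row_i q i, k) => //; rewrite /J.
  have bt : box (\row_i q i, k) (f t).
    by split => // i j; rewrite !mxE (ord1 i); apply: ball_sym.
  case: pselect => //= h; exfalso; apply: h => w bw.
  apply: be; apply: (le_ball (ltW ke)).
  rewrite mulr_natr mulr2n; apply: ball_triangle bw; exact: ball_sym.
apply: countable_bigcupT_measurable; first exact: countableP.
move=> p; rewrite /J; case: pselect => _ /=; last exact: measurable0.
have -> : f @^-1` box p = \bigcap_(i in [set: 'I_n])
    (fun t => f t ord0 i) @^-1` ball (ratr (p.1 ord0 i) : R) (p.2.+1%:R^-1).
  apply/seteqP; split => t /=.
    by move=> [_ h] i _; have := h ord0 i; rewrite mxE.
  move=> h; split; first by [].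
  by move=> i j; rewrite mxE (ord1 i); exact: h.
apply: fin_bigcap_measurable => // i _.
rewrite -[X in measurable X]setTI; apply: mf => //.
exact: measurable_ball.
Qed.

Lemma measurable_sphere (R : realType) (n : nat) :
  measurable (@sphere R n : set (Rn R n)).
Proof.
have -> : (@sphere R n : set (Rn R n)) =
    (fun w : Rn R n => \sum_(i < n) ((w : 'rV[R]_n) ord0 i) ^+ 2) @^-1` [set 1]
        by [].
rewrite -[X in measurable X]setTI.
have h : measurable_fun setT (fun w : Rn R n =>
    \sum_(i < n) ((w : 'rV[R]_n) ord0 i) ^+ 2).
  apply: measurable_sum => i; apply: measurable_funX; exact: measurable_coord.
exact: h.
Qed.

Lemma measurable_line (R : realType) (n : nat) (x : 'rV[R]_n) :
  @measurable_fun _ _ (R * Rn R n)%type (Rn R n) setT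
    (fun p => x + p.1 *: (p.2 : 'rV[R]_n)).
Proof.
apply: measurable_fun_Rn => i; under eq_fun do rewrite !mxE.
apply: measurable_funD => //; apply: measurable_funM; first exact: measurable_fst.
exact: (measurableT_comp (measurable_coord i) measurable_snd).
Qed.

Lemma measurable_sphere_slice (R : realType) (n : nat) (u : 'rV[R]_n -> R)
    (x : 'rV[R]_n) (rho : R) :
  @measurable_fun _ _ (Rn R n) R setT u ->
  measurable_fun setT (fun w : Rn R n => u (x + rho *: (w : 'rV[R]_n))).
Proof.
move=> mu.
suff h : @measurable_fun _ _ (Rn R n) (Rn R n) setT
    (fun w => x + rho *: (w : 'rV[R]_n)).
  exact: (measurableT_comp mu h).
apply: measurable_fun_Rn => i; under eq_fun do rewrite !mxE.
apply: measurable_funD => //; apply: measurable_funM => //; exact: measurable_coord.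
Qed.

Lemma integrable_sphere_slice (R : realType) (n : nat)
    (a : {finite_measure set (Rn R n) -> \bar R}) (u : 'rV[R]_n -> R) (M : R)
    (x : 'rV[R]_n) (rho : R) :
  @measurable_fun _ _ (Rn R n) R setT u -> (forall y, `|u y| <= M) ->
  a.-integrable (@sphere R n : set (Rn R n))
    (EFin \o (fun w : Rn R n => u (x + rho *: (w : 'rV[R]_n)))).
Proof.
move=> mu uM; apply: measurable_bounded_integrable.
- exact: measurable_sphere.
- by rewrite ltey_eq fin_num_measure//; exact: measurable_sphere.
- by apply: measurable_funTS; exact: measurable_sphere_slice.
- exists M; split; first exact: num_real.
  by move=> y My w _ /=; rewrite (le_trans (uM _))// ltW.
Qed.

(** The integral is not divided by the mass of a. A negative radius is meaningful: it gives the
    reflected points, so symmetric sums are values at rho and at - rho. *)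
Definition sphere_mean (R : realType) (n : nat)
    (a : {finite_measure set (Rn R n) -> \bar R}) (u : 'rV[R]_n -> R)
    (x : 'rV[R]_n) (rho : R) : R :=
  Rintegral a (@sphere R n : set (Rn R n))
    (fun w : Rn R n => u (x + rho *: (w : 'rV[R]_n))).

(** Tonelli's theorem wants a nonnegative jointly measurable integrand on the whole space: u is
    shifted by its bound M and cut off by the indicator of the sphere, and the constant M a(S) is
    subtracted afterwards. *)
Lemma measurable_sphere_mean (R : realType) (n : nat)
    (a : {finite_measure set (Rn R n) -> \bar R}) (u : 'rV[R]_n -> R) (M : R)
    (x : 'rV[R]_n) :
  @measurable_fun _ _ (Rn R n) R setT u -> (forall y, `|u y| <= M) ->
  measurable_fun setT (sphere_mean a u x).
Proof.
move=> mu uM; pose S : set (Rn R n) := @sphere R n.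
pose h (p : R * Rn R n) : \bar R :=
  ((u (x + p.1 *: (p.2 : 'rV[R]_n)) + M) * \1_S p.2)%:E.
have h0 p : (0 <= h p)%E.
  rewrite /h lee_fin mulr_ge0//.
  by have := uM (x + p.1 *: (p.2 : 'rV[R]_n)); rewrite ler_norml; lra.
have mh : measurable_fun setT h.
  apply/measurable_EFinP; apply: measurable_funM.
    apply: measurable_funD => //.
    exact: (measurableT_comp mu (measurable_line x)).
  apply: (measurableT_comp _ measurable_snd).
  by apply: measurable_indic; exact: measurable_sphere.
have mF := @measurable_fun_fubini_tonelli_F _ _ _ _ R a h mh h0.
have -> : sphere_mean a u x = (fun rho => fine (fubini_F a h rho) - M * fine (a S)).
  apply/funext => rho; rewrite /sphere_mean.
  transitivity (Rintegral a S (fun w : Rn R n => (u (x + rho *: (w : 'rV[R]_n))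
      + M)) - M * fine (a S)).
    rewrite RintegralD//; last 3 first.
    - exact: measurable_sphere.
    - exact: integrable_sphere_slice mu uM.
    - by apply: finite_measure_integrable_cst; exact: measurable_sphere.
    by rewrite Rintegral_cst ?addrK//; exact: measurable_sphere.
  congr (_ - _); rewrite /Rintegral /fubini_F integral_mkcond; congr fine.
  apply: eq_integral => w _; rewrite /h /= patchE indicE.
  by case: ifPn; rewrite ?mulr1 ?mulr0.
apply: measurable_funB => //.
by apply: (measurableT_comp _ mF); exact: fine_measurable.
Qed.

Lemma integrable_sphere_slice_opp (R : realType) (n : nat)
    (a : {finite_measure set (Rn R n) -> \bar R}) (u : 'rV[R]_n -> R) (M : R)
    (x : 'rV[R]_n) (rho : R) :
  @measurable_fun _ _ (Rn R n) R setT u -> (forall y, `|u y| <= M) ->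
  a.-integrable (@sphere R n : set (Rn R n))
    (EFin \o (fun w : Rn R n => u (x - rho *: (w : 'rV[R]_n)))).
Proof.
move=> mu uM; have := integrable_sphere_slice a x (- rho) mu uM.
by apply: eq_integrable; [exact: measurable_sphere|move=> w _ /=; rewrite scaleNr].
Qed.

Lemma integral_sphere_sym (R : realType) (n : nat)
    (a : {finite_measure set (Rn R n) -> \bar R}) (u : 'rV[R]_n -> R) (M : R)
    (x : 'rV[R]_n) (rho : R) :
  @measurable_fun _ _ (Rn R n) R setT u -> (forall y, `|u y| <= M) ->
  Rintegral a (@sphere R n : set (Rn R n)) (fun w : Rn R n =>
    u (x + rho *: (w : 'rV[R]_n)) + u (x - rho *: (w : 'rV[R]_n))) =
  sphere_mean a u x rho + sphere_mean a u x (- rho).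
Proof.
move=> mu uM; rewrite RintegralD.
- by congr (_ + _); apply: eq_Rintegral => w _; rewrite scaleNr.
- exact: measurable_sphere.
- exact: integrable_sphere_slice mu uM.
- exact: integrable_sphere_slice_opp mu uM.
Qed.

Lemma integral_delta2 (R : realType) (n : nat)
    (a : {finite_measure set (Rn R n) -> \bar R}) (u : 'rV[R]_n -> R) (M : R)
    (x : 'rV[R]_n) (rho : R) :
  @measurable_fun _ _ (Rn R n) R setT u -> (forall y, `|u y| <= M) ->
  Rintegral a (@sphere R n : set (Rn R n))
    (fun w : Rn R n => delta2 u x (rho *: (w : 'rV[R]_n))) =
  2 * u x * fine (a (@sphere R n : set (Rn R n))) -
    (sphere_mean a u x rho + sphere_mean a u x (- rho)).
Proof.
move=> mu uM; rewrite -(integral_sphere_sym _ _ _ mu uM).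
have mS := @measurable_sphere R n.
have iC : a.-integrable (@sphere R n : set (Rn R n)) (EFin \o cst (2 * u x)).
  exact: finite_measure_integrable_cst.
have iD := integrableD mS (integrable_sphere_slice a x rho mu uM)
  (integrable_sphere_slice_opp a x rho mu uM).
rewrite -Rintegral_cst// -RintegralB//.
by apply: eq_Rintegral => w _; rewrite /delta2; ring.
Qed.

(** * Second differences *)

Lemma rV_norm_le (R : realType) (n : nat) (v : 'rV[R]_n) (e : R) : 0 <= e ->
  (`|v| <= e) = [forall i, `|v ord0 i| <= e].
Proof.
move=> e0; rewrite [X in X <= _]/Num.norm/= mx_normrE.
apply/idP/forallP => [h i|h].
  apply: le_trans h; exact: (le_bigmax _ (fun ij => `|v ij.1 ij.2|) (ord0, i)).
apply/bigmax_leP; split => // -[i j] _ /=; by rewrite (ord1 i) h.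
Qed.

Lemma line_is_derive (R : realType) (n : nat) (v : 'rV[R]_n -> R)
    (p e : 'rV[R]_n) (t : R) :
  derivable v (p + t *: e) e ->
  is_derive t 1 (fun s : R => v (p + s *: e)) ('D_e v (p + t *: e)).
Proof.
move=> dv.
have E : (fun h : R => h^-1 *: (v (p + (h *: 1 + t) *: e) - v (p + t *: e))) =
   (fun h : R => h^-1 *: (v (h *: e + (p + t *: e)) - v (p + t *: e))).
  apply/funext => h; congr (_ *: (v _ - _)).
  have -> : h%:A = h by rewrite /GRing.scale/= mulr1.
  by rewrite scalerDl addrCA.
split; first by rewrite /derivable E.
by rewrite /derive E.
Qed.

(** [C2_on] speaks of partial derivatives only, so the mean value theorem is applied along n
    segments parallel to the axes, each costing at most B |p - q|. The norm is the sup norm, so its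
    balls are boxes and contain these segments. *)
Lemma rV_coord_lipschitz (R : realType) (n : nat) (v : 'rV[R]_n -> R) (c : 'rV[R]_n)
    (d B : R) : 0 <= B ->
  (forall y, `|y - c| <= d -> forall i, derivable v y (ebase i)) ->
  (forall y, `|y - c| <= d -> forall i, `|'D_(ebase i) v y| <= B) ->
  forall p q, `|p - c| <= d -> `|q - c| <= d -> `|v p - v q| <= n%:R * B * `|p - q|.
Proof.
move=> B0 dv bv p q hp hq.
have d0 : 0 <= d by apply: le_trans hp.
(* z interpolates between q and p one coordinate at a time. *)
pose z (k : nat) : 'rV[R]_n := \row_i (if (i < k)%N then p ord0 i else q ord0 i).
have z0 : z 0%N = q by apply/rowP => i; rewrite mxE.
have zn : z n = p by apply/rowP => i; rewrite mxE ltn_ord.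
have step k (kn : (k < n)%N) : `|v (z k.+1) - v (z k)| <= B * `|p - q|.
  pose i := Ordinal kn; pose D := p ord0 i - q ord0 i.
  have zS : z k.+1 = z k + D *: ebase i.
    apply/rowP => j; rewrite !mxE eqxx/= ltnS.
    have [jk|jk|jk] := ltngtP j k.
    - by rewrite (_ : j == i = false) ?mulr0 ?addr0//; apply/negP => /eqP ji;
        move: jk; rewrite ji ltnn.
    - by rewrite (_ : j == i = false) ?mulr0 ?addr0//; apply/negP => /eqP ji;
        move: jk; rewrite ji ltnn.
    - have -> : j = i by apply: val_inj.
      by rewrite eqxx mulr1 /D addrC subrK.
  have DB : `|D| <= `|p - q|.
    have := lexx `|p - q|; rewrite {1}rV_norm_le// => /forallP/(_ i).
    by rewrite !mxE.
  have inb (t : R) : 0 <= t <= 1 -> `|z k + (t * D) *: ebase i - c| <= d.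
    move=> /andP[t0 t1]; rewrite rV_norm_le//; apply/forallP => j.
    move: hp hq; rewrite !rV_norm_le// => /forallP/(_ j) + /forallP/(_ j).
    rewrite !mxE eqxx/=; have [->|ji] := eqVneq j i.
      rewrite ltnn mulr1 /D !ler_norml => /andP[p1 p2] /andP[q1 q2].
      move: (p ord0 i) (q ord0 i) (c ord0 i) p1 p2 q1 q2 => P Q C p1 p2 q1 q2.
      by apply/andP; split; nra.
    by rewrite mulr0 addr0; case: ifP.
  pose f (t : R) := v (z k + (t * D) *: ebase i).
  pose df (t : R) := 'D_(ebase i) v (z k + (t * D) *: ebase i) * D.
  have fd (t : R) : 0 <= t <= 1 -> is_derive t 1 f (df t).
    move=> t01.
    have h1 := @line_is_derive _ _ v (z k) (ebase i) (t * D) (dv _ (inb t t01) i).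
    have h2 : is_derive t 1 (fun s : R => s * D) D.
      by apply: is_derive_eq; rewrite /GRing.scale/= mulr1 mulr0 add0r.
    have h3 := @is_derive1_comp R (fun s : R => v (z k + s *: ebase i))
        (fun s => s * D) t _ _ h1 h2.
    exact: h3.
  have fc : {within `[0, 1], continuous f}.
    apply: derivable_within_continuous => t; rewrite in_itv/= => t01.
    by have := fd t t01 => ?; exact: ex_derive.
  have fo (t : R) : t \in `]0, 1[ -> is_derive t 1 f (df t).
    by rewrite in_itv/= => /andP[t0 t1]; apply: fd; rewrite !ltW.
  have [t t01] := MVT ltr01 fo fc.
  rewrite /f mul0r scale0r addr0 mul1r -zS subr0 mulr1 => ->.
  rewrite /df normrM ler_pM//; apply: bv; apply: inb.
  by move: t01; rewrite in_itv/= => /andP[? ?]; rewrite !ltW.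
have : forall k, (k <= n)%N -> `|v (z k) - v q| <= k%:R * (B * `|p - q|).
  elim=> [|k IH] kn; first by rewrite z0 subrr normr0 mul0r.
  have -> : v (z k.+1) - v q = (v (z k.+1) - v (z k)) + (v (z k) - v q) by ring.
  rewrite (le_trans (ler_normD _ _))// -addn1 natrD mulrDl mul1r addrC.
  by apply: lerD; [apply: IH; exact: ltnW|rewrite addn1; exact: step].
by move=> /(_ n (leqnn n)); rewrite zn mulrA.
Qed.

Lemma is_derive_line (R : realType) (n : nat) (w : 'rV[R]_n -> R)
    (y e : 'rV[R]_n) (l : R) :
  is_derive (0 : R) 1 (fun s : R => w (y + s *: e)) l -> is_derive y e w l.
Proof.
move=> [dw El].
have E : (fun h : R => h^-1 *: (w (y + (h *: 1 + 0) *: e) - w (y + (0 : R) *: e))) =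
   (fun h : R => h^-1 *: (w (h *: e + y) - w y)).
  apply/funext => h; have -> : h%:A = h by rewrite /GRing.scale/= mulr1.
  by rewrite !addr0 scale0r addr0 [y + _]addrC.
split; first by move: dw; rewrite /derivable E.
by move: El; rewrite /derive E.
Qed.

Lemma is_derive_reflect_sum (R : realType) (n : nat) (u : 'rV[R]_n -> R)
    (x y e : 'rV[R]_n) :
  derivable u (x + y) e -> derivable u (x - y) e ->
  is_derive y e (fun z => u (x + z) + u (x - z)) ('D_e u (x + y) - 'D_e u (x - y)).
Proof.
move=> d1 d2; apply: is_derive_line.
have h1 : is_derive (0 : R) 1 (fun s : R => u ((x + y) + s *: e)) ('D_e u (x + y)).
  rewrite -[X in 'D_e u X]addr0 -(scale0r e); apply: line_is_derive.
  by rewrite scale0r addr0.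
have h2 : is_derive (- (0 : R)) 1 (fun s : R => u ((x - y) + s *: e)) ('D_e u
    (x - y)).
  rewrite oppr0 -[X in 'D_e u X]addr0 -(scale0r e); apply: line_is_derive.
  by rewrite scale0r addr0.
have hN : is_derive (0 : R) 1 (fun s : R => - s) (- 1) by apply: is_deriveN.
have h3 := @is_derive1_comp R (fun s : R => u ((x - y) + s *: e))
    (fun s => - s) 0 _ _ h2 hN.
rewrite (_ : (fun s : R => _) = (fun s : R => u ((x + y) + s *: e)) +
   ((fun s : R => u ((x - y) + s *: e)) \o (fun s => - s))); last first.
  apply/funext => s; rewrite !fctE/= scaleNr addrA; congr (_ + u _).
  by rewrite opprD addrA.
rewrite mulrN1 in h3.
exact: is_deriveD h1 h3.
Qed.

(** [rV_coord_lipschitz] is used twice: for the first partials of u, then for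
    z |-> u (x + z) + u (x - z), whose partials are differences of the former. *)
Lemma delta2_quadratic (R : realType) (n : nat) (O : set 'rV[R]_n)
    (u : 'rV[R]_n -> R)
    (x : 'rV[R]_n) : open O -> C2_on O u -> O x ->
  exists d K, [/\ 0 < d, 0 <= K &
    forall y, `|y| <= d -> `|delta2 u x y| <= K * `|y| ^+ 2].
Proof.
move=> oO hu Ox.
(* One constant for all pairs i, j: it exceeds each second partial at x by at least 1, the tolerance
   used in the continuity argument. *)
pose B := 1 + \sum_i \sum_j `|'D_(ebase j) ('D_(ebase i) u) x|.
have B0 : 0 <= B by apply: addr_ge0 => //; apply: sumr_ge0 => i _; apply: sumr_ge0.
have nB : \forall y \near x, O y /\
    forall i j : 'I_n, `|'D_(ebase j) ('D_(ebase i) u) y| <= B.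
  near=> y; split.
    by near: y; exact: open_nbhs_nbhs.
  near: y; apply: filter_forall => i; apply: filter_forall => j.
  have [_ /(_ i j) [_ _ _ cD]] := hu x Ox.
  have /cvgr_dist_le /(_ 1 ltr01) := cD.
  apply: filterS => y hy.
  have hb : `|'D_(ebase j) ('D_(ebase i) u) x| <=
      \sum_i \sum_j `|'D_(ebase j) ('D_(ebase i) u) x|.
    apply: (@le_trans _ _ (\sum_k `|'D_(ebase k) ('D_(ebase i) u) x|)).
      by rewrite (bigD1 j)//= lerDl; apply: sumr_ge0.
    rewrite [leRHS](bigD1 i)//= lerDl; apply: sumr_ge0 => k _.
    by apply: sumr_ge0.
  have tri (b c : R) : `|c| <= `|b - c| + `|b|
      by rewrite addrC -{1}(subKr b c) ler_normB.
  apply: (le_trans (tri ('D_(ebase j) ('D_(ebase i) u) x) _)).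
  exact: lerD hy hb.
move/nbhs_ballP: nB => [e /= e0 be].
pose d := e / 2.
have d0 : 0 < d by rewrite divr_gt0.
have inO y : `|y - x| <= d -> O y /\
    forall i j : 'I_n, `|'D_(ebase j) ('D_(ebase i) u) y| <= B.
  move=> hy; apply: be; rewrite mx_norm_ball /ball_/= distrC (le_lt_trans hy)//.
  by rewrite /d ltr_pdivrMr// ltr_pMr// ltr1n.
have lip i p q : `|p - x| <= d -> `|q - x| <= d ->
    `|'D_(ebase i) u p - 'D_(ebase i) u q| <= n%:R * B * `|p - q|.
  apply: (@rV_coord_lipschitz _ _ ('D_(ebase i) u) x d B) => // y hy j.
    by have [Oy _] := inO y hy; have [_ hC] := hu y Oy; have [_ ? _ _] := hC i j.
  by have [_] := inO y hy; exact.
(* The first partials at x + z and x - z, at distance 2|z| <= 2|y|, differ by at most n B 2|y|; the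
   outer factor n comes from the Lipschitz bound for [phi] between y and 0. *)
exists d, (n%:R * (n%:R * B * 2)); split => //.
  by rewrite !mulr_ge0.
move=> y yd.
pose phi z := u (x + z) + u (x - z).
have inx z : `|z| <= `|y| -> `|x + z - x| <= d /\ `|x - z - x| <= d.
  move=> zy; split; first by rewrite addrC addKr (le_trans zy).
  by rewrite addrC addKr normrN (le_trans zy).
have dphi z i : `|z - 0| <= `|y| -> is_derive z (ebase i) phi
    ('D_(ebase i) u (x + z) - 'D_(ebase i) u (x - z)).
  rewrite subr0 => /inx [z1 z2]; apply: is_derive_reflect_sum.
    by have [Oy _] := inO _ z1; have [_ hC] := hu _ Oy; have [? _ _ _] := hC i i.
  by have [Oy _] := inO _ z2; have [_ hC] := hu _ Oy; have [? _ _ _] := hC i i.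
have := @rV_coord_lipschitz R n phi 0 `|y| (n%:R * B * (2 * `|y|)).
have b0 : 0 <= n%:R * B * (2 * `|y|) by rewrite !mulr_ge0.
move=> /(_ b0).
have h1 z : `|z - 0| <= `|y| -> forall i, derivable phi z (ebase i).
  by move=> zy i; have := dphi z i zy => ?; exact: ex_derive.
have h2 z : `|z - 0| <= `|y| -> forall i, `|'D_(ebase i) phi z| <= n%:R * B *
    (2 * `|y|).
  move=> zy i; have := dphi z i zy => ?; rewrite derive_val.
  move: zy; rewrite subr0 => zy; have [z1 z2] := inx _ zy.
  apply: (le_trans (lip i _ _ z1 z2)); rewrite ler_wpM2l ?mulr_ge0//.
  rewrite opprD opprK addrACA subrr add0r -mulr2n normrMn.
  by rewrite -[leLHS]mulr_natl ler_pM2l.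
move=> /(_ h1 h2 y 0); rewrite !subr0 normr0 => /(_ (lexx _) (normr_ge0 _)).
have -> : phi y - phi 0 = - delta2 u x y.
  by rewrite /phi /delta2 addr0 subr0; ring.
rewrite normrN => h; apply: (le_trans h).
by rewrite le_eqVlt; apply/orP; left; apply/eqP; ring.
Unshelve. all: by end_near. Qed.

(** * The expansion *)

Lemma dominated_Rintegral d (T : measurableType d) (R : realType)
    (mu : {measure set T -> \bar R}) (D : set T) (f h : T -> R) (B : R) :
  measurable D -> measurable_fun D f -> measurable_fun D h ->
  (forall x, D x -> `|f x| <= h x) -> (\int[mu]_(x in D) (h x)%:E <= B%:E)%E ->
  mu.-integrable D (EFin \o f) /\ `|Rintegral mu D f| <= B.
Proof.
move=> mD mf mh fh hB.
have le_int : (\int[mu]_(x in D) `|(f x)%:E| <= B%:E)%E.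
  apply: le_trans hB; apply: ge0_le_integral => //.
  - by apply: measurableT_comp => //; exact/measurable_EFinP.
  - exact/measurable_EFinP.
have fi : mu.-integrable D (EFin \o f).
  apply/integrableP; split; first exact/measurable_EFinP.
  by apply: le_lt_trans le_int _; rewrite ltry.
split => //; rewrite -lee_fin EFin_normr_Rintegral//.
apply: le_trans le_int; apply: le_abse_integral => //; exact/measurable_EFinP.
Qed.

Lemma sphere_norm_le1 (R : realType) (n : nat) (w : 'rV[R]_n) :
  @sphere R n w -> `|w| <= 1.
Proof.
move=> Sw; rewrite rV_norm_le//; apply/forallP => i.
rewrite -ler_sqr ?nnegrE// expr1n real_normK ?num_real//.
rewrite /sphere/= in Sw; rewrite -Sw (bigD1 i)//= lerDl.
by apply: sumr_ge0 => j _; exact: sqr_ge0.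
Qed.

(** Where |y| > d, boundedness gives |delta2| <= 4M <= (4M / d^2) |y|^2. *)
Lemma delta2_global_quadratic (R : realType) (n : nat) (O : set 'rV[R]_n)
    (u : 'rV[R]_n -> R) (x : 'rV[R]_n) (M : R) :
  open O -> C2_on O u -> O x -> (forall y, `|u y| <= M) ->
  exists2 K, 0 <= K & forall y, `|delta2 u x y| <= K * `|y| ^+ 2.
Proof.
move=> oO hu Ox uM; have [d [K [d0 K0 hK]]] := delta2_quadratic oO hu Ox.
have M0 : 0 <= M by apply: le_trans (uM 0).
have c0 : 0 <= 4 * M / d ^+ 2 by rewrite !mulr_ge0 ?invr_ge0 ?sqr_ge0.
exists (K + 4 * M / d ^+ 2) => [|y]; first exact: addr_ge0.
have [yd|yd] := leP `|y| d.
  by apply: (le_trans (hK y yd)); rewrite ler_wpM2r ?sqr_ge0// lerDl.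
have h4 : `|delta2 u x y| <= 4 * M.
  have := uM x; have := uM (x - y); have := uM (x + y).
  rewrite /delta2 !ler_norml.
  move: (u x) (u (x - y)) (u (x + y)) => p q t /andP[? ?] /andP[? ?] /andP[? ?].
  by apply/andP; split; lra.
have h5 : d ^+ 2 <= `|y| ^+ 2 by rewrite ler_sqr ?nnegrE ?(ltW d0)// ltW.
have h6 : 4 * M / d ^+ 2 * d ^+ 2 <= 4 * M / d ^+ 2 * `|y| ^+ 2
    by rewrite ler_wpM2l.
rewrite divfK in h6; last by rewrite expf_neq0// lt0r_neq0.
apply: (le_trans h4); apply: (le_trans h6).
by rewrite ler_wpM2r ?sqr_ge0// lerDr.
Qed.

Lemma Rintegral_sphere_le (R : realType) (n : nat)
    (a : {finite_measure set (Rn R n) -> \bar R}) (f : Rn R n -> R) (c : R) :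
  measurable_fun setT f -> (forall w, @sphere R n w -> `|f w| <= c) ->
  `|Rintegral a (@sphere R n : set (Rn R n)) f| <=
    c * fine (a (@sphere R n : set (Rn R n))).
Proof.
move=> mf fc; have mS := @measurable_sphere R n.
have [||||_ //] := @dominated_Rintegral _ (Rn R n) R a
    (@sphere R n : set (Rn R n)) f (cst c)
  (c * fine (a (@sphere R n : set (Rn R n)))) mS.
- exact: measurable_funTS.
- exact: measurable_cst.
- exact: fc.
- have e := integral_cst a mS c%:E.
  by rewrite EFinM fineK ?fin_num_measure// -e.
Qed.

Lemma measurable_mean_kernel (R : realType) (s r : R) : 0 < r ->
  measurable_fun (`]r, +oo[%classic : set R)
    (fun x => ((x ^+ 2 - r ^+ 2) `^ s * x)^-1).
Proof.
move=> r0.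
(* For x > r the kernel is a product of real powers, which are measurable on the whole line. *)
apply: (@eq_measurable_fun _ _ _ _ _
   (fun x : R => (x ^+ 2 - r ^+ 2) `^ (- s) * x `^ (- 1))) => [x|].
  rewrite inE/= in_itv/= andbT => rx.
  by rewrite powRN powR_inv1 ?invfM// ltW// (lt_trans r0).
apply: measurable_funM; last first.
  by apply: measurable_funTS; exact: measurable_powR.
apply: (measurableT_comp (@measurable_powR _ (- s))).
by apply: measurable_funB => //; exact: measurable_funX.
Qed.

(** This gives the sign of the kernel difference and lets integrability pass from the mean kernel to
    the nonlocal one away from 0. *)
Lemma mean_kernel_ge (R : realType) (s r x : R) : 0 < s -> 0 < r -> r < x ->
  0 <= (x `^ (1 + 2 * s))^-1 <= ((x ^+ 2 - r ^+ 2) `^ s * x)^-1.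
Proof.
move=> s0 r0 rx; have x0 : 0 < x by apply: lt_trans rx.
have q0 : 0 < x ^+ 2 - r ^+ 2 by rewrite subr_gt0 ltr_sqr ?nnegrE ?ltW.
rewrite invr_ge0 powR_ge0/= lef_pV2 ?posrE ?mulr_gt0 ?powR_gt0//.
rewrite powR_1D2// mulrC ler_pM2l//.
by apply: (ge0_ler_powR (ltW s0));
    rewrite ?nnegrE ?sqr_ge0 ?(ltW q0)// gerBl sqr_ge0.
Qed.

Lemma dominated_Rintegral_lebesgue (R : realType) (D : set R) (f h : R -> R)
    (Q B : R) :
  measurable D -> measurable_fun D f -> measurable_fun D h -> 0 <= Q ->
  (forall x, D x -> 0 <= h x) -> (forall x, D x -> `|f x| <= Q * h x) ->
  (\int[lebesgue_measure]_(x in D) (h x)%:E <= B%:E)%E ->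
  lebesgue_measure.-integrable D (EFin \o f) /\
  `|\int[lebesgue_measure]_(x in D) f x| <= Q * B.
Proof.
move=> mD mf mh Q0 h0 fh hB.
have mQh : measurable_fun D (fun x => Q * h x) by exact: measurable_funM.
have hQB : (\int[lebesgue_measure]_(x in D) (Q * h x)%:E <= (Q * B)%:E)%E.
  under eq_integral do rewrite EFinM.
  rewrite ge0_integralZl//=.
  - by rewrite EFinM lee_wpmul2l ?lee_fin.
  - by apply/measurable_EFinP; exact: mh.
refine (@dominated_Rintegral _ _ R (@lebesgue_measure R) D f _ (Q * B)
    mD mf mQh fh hQB).
Qed.

Lemma integrable_setU d (T : measurableType d) (R : realType)
    (mu : {measure set T -> \bar R}) (A B : set T) (f : T -> \bar R) :
  measurable A -> measurable B -> [disjoint A & B] ->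
  mu.-integrable A f -> mu.-integrable B f -> mu.-integrable (A `|` B) f.
Proof.
move=> mA mB AB /integrableP[mfA fA] /integrableP[mfB fB].
have mf : measurable_fun (A `|` B) f by apply/measurable_funU.
apply/integrableP; split => //.
rewrite ge0_integral_setU//; first exact: lte_add_pinfty.
exact: measurableT_comp.
Qed.

Lemma integrable_mean_kernel (R : realType) (s r N : R) (g : R -> R) :
  0 < s < 1 -> 0 < r -> measurable_fun setT g -> (forall x, `|g x| <= N) ->
  lebesgue_measure.-integrable (`]r, +oo[%classic : set R)
    (EFin \o (fun x => g x * ((x ^+ 2 - r ^+ 2) `^ s * x)^-1)).
Proof.
move=> s01 r0 mg gN; have mI := measurable_itv `]r, +oo[.
have mk := @measurable_mean_kernel R s r r0.
have k0 x : `]r, +oo[%classic x -> 0 <= ((x ^+ 2 - r ^+ 2) `^ s * x)^-1.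
  rewrite /= in_itv/= andbT => rx; have /andP[s0 _] := s01.
  by have /andP[] := mean_kernel_ge s0 r0 rx; exact: le_trans.
have Ik := integral_mean_kernel s01 r0.
have N0 : 0 <= N by apply: le_trans (gN 0).
have [|||ii _] := @dominated_Rintegral_lebesgue R _
  (fun x => g x * ((x ^+ 2 - r ^+ 2) `^ s * x)^-1)
  (fun x => ((x ^+ 2 - r ^+ 2) `^ s * x)^-1) N
  ((r ^+ 2) `^ (- s) / 2 * (pi / sin (pi * s))) mI _ mk N0 k0.
- by apply: measurable_funM => //; exact: measurable_funTS.
- by move=> x /k0 h; rewrite normrM [`|_^-1|]ger0_norm// ler_wpM2r.
- by rewrite Ik lexx.
- exact: ii.
Qed.

(** The bound N provides integrability against the mean kernel, while the quadratic bound Q x^2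
    provides the estimate, on (0, r] and on (r, oo) separately. *)
Lemma mean_nonlocal_diff_le (R : realType) (s r Q N : R) (g : R -> R) :
  0 < s < 1 -> 0 < r -> measurable_fun setT g -> (forall x, `|g x| <= N) ->
  0 <= Q -> (forall x, `|g x| <= Q * x ^+ 2) ->
  `|\int[lebesgue_measure]_(x in `]r, +oo[)
      (g x * ((x ^+ 2 - r ^+ 2) `^ s * x)^-1) -
    \int[lebesgue_measure]_(x in `]0, +oo[) (g x / x `^ (1 + 2 * s))| <=
  Q * ((r ^+ 2) `^ (1 - s) / (1 - s)).
Proof.
move=> s01 r0 mg gN Q0 gQ; have /andP[s0 s1] := s01.
(* The two error integrals share the bound b, and 2b is the factor of Q in the conclusion. *)
pose b := (r ^+ 2) `^ (1 - s) / (2 * (1 - s)).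
pose k1 (x : R) := ((x ^+ 2 - r ^+ 2) `^ s * x)^-1.
pose k2 (x : R) := (x `^ (1 + 2 * s))^-1.
pose I1 : set R := `]0, r]%classic; pose I2 : set R := `]r, +oo[%classic.
have mI1 : measurable I1 by exact: measurable_itv.
have mI2 : measurable I2 by exact: measurable_itv.
have mk1 : measurable_fun I2 k1 by exact: measurable_mean_kernel.
have mk2 (D : set R) : measurable_fun D k2.
  apply: measurable_funTS; rewrite (_ : k2 = fun x => x `^ (- (1 + 2 * s))).
    exact: measurable_powR.
  by apply/funext => x; rewrite /k2 powRN.
have msq (D : set R) : measurable_fun D (fun x : R => x ^+ 2).
  by apply: measurable_funTS; exact: measurable_funX.
have mgD (D : set R) : measurable_fun D g by exact: measurable_funTS.
have kk x : I2 x -> 0 <= k2 x <= k1 x.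
  by rewrite /I2/= in_itv/= andbT => h; exact: mean_kernel_ge.
have k20 x : 0 <= k2 x by rewrite /k2 invr_ge0 powR_ge0.
have dk0 x : I2 x -> 0 <= k1 x - k2 x by move=> /kk /andP[_]; rewrite subr_ge0.
have i1 : lebesgue_measure.-integrable I2 (EFin \o (fun x => g x * k1 x)).
  exact: integrable_mean_kernel mg gN.
have i2 : lebesgue_measure.-integrable I2 (EFin \o (fun x => g x * k2 x)).
  apply: le_integrable i1 => //.
    by apply/measurable_EFinP; apply: measurable_funM; [exact: mgD|exact: mk2].
  move=> x /kk /andP[h1 h2]; rewrite /= lee_fin !normrM ler_wpM2l//.
  by rewrite !ger0_norm//; exact: le_trans h2.
have mh1 : measurable_fun I1 (fun x => x ^+ 2 * k2 x).
  by apply: measurable_funM; [exact: msq|exact: mk2].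
have mh2 : measurable_fun I2 (fun x => x ^+ 2 * (k1 x - k2 x)).
  by apply: measurable_funM; [exact: msq|apply: measurable_funB => //; exact: mk2].
have mgk2 (D : set R) : measurable_fun D (fun x => g x * k2 x).
  by apply: measurable_funM; [exact: mgD|exact: mk2].
have mgk : measurable_fun I2 (fun x => g x * k1 x - g x * k2 x).
  by apply: measurable_funB; [apply: measurable_funM => //; exact: mgD|exact: mgk2].
have [|||i3 B1] := @dominated_Rintegral_lebesgue R I1 (fun x => g x * k2 x)
    (fun x => x ^+ 2 * k2 x) Q b mI1 (mgk2 _) mh1 Q0.
- by move=> x _; rewrite mulr_ge0 ?sqr_ge0.
- by move=> x _; rewrite normrM mulrA [`|k2 _|]ger0_norm// ler_wpM2r.
- exact: integral_near_origin_le.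
have [|||_ B2] := @dominated_Rintegral_lebesgue R I2
    (fun x => g x * k1 x - g x * k2 x)
    (fun x => x ^+ 2 * (k1 x - k2 x)) Q b mI2 mgk mh2 Q0.
- by move=> x I2x; rewrite mulr_ge0 ?sqr_ge0 ?dk0.
- move=> x I2x; rewrite -mulrBr normrM mulrA [`|_ - _|]ger0_norm ?dk0//.
  by rewrite ler_wpM2r ?dk0.
- exact: integral_kernel_diff_le.
have U : `]0, +oo[%classic = I1 `|` I2.
  apply/seteqP; split => y; rewrite /I1 /I2 /= !in_itv/= !andbT.
    by move=> y0; have [yr|yr] := leP y r; [left; rewrite y0|right].
  by move=> [/andP[]//|]; exact: lt_trans.
have dj : [disjoint I1 & I2].
  apply/disj_setPS => y; rewrite /I1 /I2 /= !in_itv/= andbT => -[/andP[_ yr]].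
  by rewrite ltNge yr.
(* After splitting at r the difference is the integral of g (k1 - k2) over [I2] minus that of g k2
   over [I1]. *)
rewrite U Rintegral_setU//; last first.
  exact: integrable_setU.
rewrite opprD addrCA addrC -RintegralB//.
apply: (le_trans (ler_normB _ _)).
rewrite (_ : Q * _ = Q * b + Q * b); first exact: lerD.
by rewrite /b; field; rewrite lt0r_neq0//; lra.
Qed.

Theorem theorem2p2 (R : realType) (n : nat) (s : R)
  (hs0 : 0 < s) (hs1 : s < 1)
  (a : {finite_measure set (Rn R n) -> \bar R})
  (ha_supp : a (~` (@sphere R n : set (Rn R n))) = 0%E)
  (ha_pos : (0 < a (@sphere R n : set (Rn R n)))%E)
  (O : set 'rV[R]_n) (hO : open O)
  (u : 'rV[R]_n -> R) (hu2 : C2_on O u)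
  (hu_meas : @measurable_fun _ _ (Rn R n) R setT u)
  (hu_bdd : exists M : R, forall y, `|u y| <= M)
  (x : 'rV[R]_n) (hx : O x) :
  exists C : R, exists r0 : R, 0 < r0 /\
    forall r : R, 0 < r -> r < r0 ->
      `| u x - Mop s a r u x - cnsa s a * r `^ (2 * s) * Lop s a u x |
        <= C * r ^+ 2.
Proof.
have [M uM] := hu_bdd.
have M0 : 0 <= M by apply: le_trans (uM 0).
have s01 : 0 < s < 1 by rewrite hs0.
have [K K0 hK] := delta2_global_quadratic hO hu2 hx uM.
set S : set (Rn R n) := @sphere R n.
set A := fine (a S).
have mS : measurable S := @measurable_sphere R n.
have A0 : 0 < A.
  by rewrite fine_gt0// ha_pos ltey_eq fin_num_measure.
pose G (rho : R) := sphere_mean a u x rho + sphere_mean a u x (- rho).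
pose g (rho : R) := 2 * u x * A - G rho.
have mg : measurable_fun setT g.
  have mm := @measurable_sphere_mean R n a u M x hu_meas uM.
  apply: measurable_funB => //; apply: measurable_funD => //.
  apply: (measurableT_comp mm); exact: oppr_measurable.
have md (rho : R) : measurable_fun setT
    (fun w : Rn R n => delta2 u x (rho *: (w : 'rV[R]_n))).
  have m1 := measurable_sphere_slice x rho hu_meas.
  have m2 := measurable_sphere_slice x (- rho) hu_meas.
  rewrite /delta2; apply: measurable_funB => //; apply: measurable_funB => //.
  by move: m2; congr (measurable_fun _ _); apply/funext => w; rewrite scaleNr.
have gE (rho : R) : Rintegral a S (fun w : Rn R n =>
    delta2 u x (rho *: (w : 'rV[R]_n))) = g rho.
  exact: integral_delta2 hu_meas uM.
have gK (rho : R) : `|g rho| <= K * A * rho ^+ 2.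
  rewrite -gE mulrAC; apply: Rintegral_sphere_le => // w Sw.
  apply: (le_trans (hK _)); rewrite ler_wpM2l// mx_normZ exprMn.
  rewrite real_normK ?num_real// ler_piMr ?sqr_ge0// expr_le1//.
  exact: sphere_norm_le1.
have gM (rho : R) : `|g rho| <= 4 * M * A.
  rewrite -gE; apply: Rintegral_sphere_le => // w _.
  have := uM x; have := uM (x - rho *: w); have := uM (x + rho *: w).
  rewrite /delta2 !ler_norml.
  move: (u x) (u (x - _)) (u (x + _)) => p q t /andP[? ?] /andP[? ?] /andP[? ?].
  by apply/andP; split; lra.
have KA0 : 0 <= K * A by rewrite mulr_ge0// ltW.
(* K A is the quadratic constant of g and 1/(1 - s) comes from the two error integrals. The estimate
   is uniform in r > 0, so the threshold 1 is arbitrary. *)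
exists (`|cnsa s a| * (K * A / (1 - s))), 1; split => // r r0 _.
have LE : Lop s a u x = \int[lebesgue_measure]_(rho in `]0, +oo[)
    (g rho / rho `^ (1 + 2 * s)).
  by apply: eq_Rintegral => rho _; rewrite gE.
pose k1 (rho : R) := ((rho ^+ 2 - r ^+ 2) `^ s * rho)^-1.
pose kap := (r ^+ 2) `^ (- s) / 2 * (pi / sin (pi * s)).
have Ik1 : \int[lebesgue_measure]_(rho in `]r, +oo[) k1 rho = kap.
  by rewrite /Rintegral integral_mean_kernel.
have ikc (c : R) : lebesgue_measure.-integrable (`]r, +oo[%classic : set R)
    (EFin \o (fun rho => c * k1 rho)).
  exact: (@integrable_mean_kernel R s r `|c| (cst c) s01 r0 (measurable_cst _)
      (fun=> lexx _)).
have ik1 : lebesgue_measure.-integrable (`]r, +oo[%classic : set R) (EFin \o k1).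
  by have := ikc 1; congr (integrable _ _ _); apply/funext => rho; rewrite /= mul1r.
have igk1 := integrable_mean_kernel s01 r0 mg gM.
(* The symmetric sum is 2 u(x) A - g; its constant part integrates to a multiple of [kap]. *)
have ME : Mop s a r u x = cnsa s a * r `^ (2 * s) * (2 * u x * A * kap -
    \int[lebesgue_measure]_(rho in `]r, +oo[) (g rho * k1 rho)).
  have ic := ikc (2 * u x * A).
  rewrite /Mop -Ik1 -RintegralZl// -RintegralB//.
  congr (_ * _); apply: eq_Rintegral => rho _.
  by rewrite (integral_sphere_sym a x rho hu_meas uM) -/(G rho) -/(k1 rho) /g; ring.
have sin0 : 0 < sin (pi * s).
  apply: sin_gt0_pi; have := pi_gt0 R => pi0.
  by rewrite mulr_gt0//= gtr_pMr.
have cancel (t p B P : R) : 0 < t -> 0 < p -> 0 < B -> 0 < P ->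
    t / p / B * P * (2 * B * (P^-1 / 2 * (p / t))) = 1.
  by move=> t0 p0 B0 P0; field; rewrite !lt0r_neq0.
(* The constant c(n,s,a) is exactly what makes the mean operator fix constants; the 2 counts the
   points x + rho w and x - rho w. *)
have cE : cnsa s a * r `^ (2 * s) * (2 * A * kap) = 1.
  rewrite /cnsa /kap powR_2M ?(ltW r0)// powRN -/S /A.
  have P0 := powR_gt0 s (exprn_gt0 2 r0); have pi0 := pi_gt0 R.
  exact: cancel.
(* By this normalisation u(x) cancels, and the whole error is c r^(2s) times the difference of the
   mean and nonlocal integrals of g. *)
have solve (w c B k I J : R) : c * (2 * B * k) = 1 ->
    w - c * (2 * w * B * k - I) - c * J = c * (I - J).
  move=> h; transitivity (w * (1 - c * (2 * B * k)) + c * (I - J)); first by ring.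
  by rewrite h subrr mulr0 add0r.
have D : `|\int[lebesgue_measure]_(rho in `]r, +oo[) (g rho * k1 rho) -
    \int[lebesgue_measure]_(rho in `]0, +oo[) (g rho / rho `^ (1 + 2 * s))| <=
    K * A * ((r ^+ 2) `^ (1 - s) / (1 - s)).
  exact: mean_nonlocal_diff_le mg gM KA0 gK.
rewrite LE ME.
rewrite [X in `|X|](_ : _ = cnsa s a * r `^ (2 * s) *
  (\int[lebesgue_measure]_(rho in `]r, +oo[) (g rho * k1 rho) -
   \int[lebesgue_measure]_(rho in `]0, +oo[) (g rho / rho `^ (1 + 2 * s))));
       last first.
  exact: solve cE.
rewrite normrM; apply: (le_trans (ler_wpM2l (normr_ge0 _) D)).
rewrite normrM [`|r `^ _|]ger0_norm ?powR_ge0// powR_2M ?(ltW r0)//.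
(* The prefactor r^(2s) and the bound of order r^(2-2s) multiply to r^2. *)
have e : (r ^+ 2) `^ s * (r ^+ 2) `^ (1 - s) = r ^+ 2.
  by rewrite -powRD ?subrKC ?powRr1 ?sqr_ge0// oner_eq0.
rewrite -[in leRHS]e le_eqVlt; apply/orP; left; apply/eqP.
by move: `|_| (_ `^ s) (_ `^ (1 - s)) (_^-1) (K * A) => c p q v k; ring.
Qed.
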